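(* Let $\mathbf k$ be a field, $G$ a finite group with $\operatorname{char}\mathbf k$ zero or coprime to $|G|$, and $\mathcal D$ a $\mathbf k$-linear cocomplete triangulated category with a dg-enhancement to which a given $G$-action on $\mathcal D$ lifts, and such that $\mathcal D^c$ is Hom-finite. Let $$(E_{1,1},\dots,E_{1,\ell_1},E_{2,1},\dots,E_{2,\ell_2},\dots,E_{k,1},\dots,E_{k,\ell_k})\qquad(\ast)$$ be a full exceptional collection in $\mathcal D$ such that for each $i=1,\dots,k$ there is a transitive $G$-action on $\{1,\dots,\ell_i\}$ with $g_*E_{i,j}\cong E_{i,g(j)}$ for all $g\in G$, $j\in\{1,\dots,\ell_i\}$. Let $H_i\le G$ be the stabiliser of $1\in\{1,\dots,\ell_i\}$, and assume that for each $i$ there is $\mathcal E_i\in\mathcal D^{H_i}$ with $\operatorname{Res}_{H_i}^1(\mathcal E_i)=E_{i,1}$. Put $F_{i,\rho}=\operatorname{Ind}_{H_i}^G(\rho\otimes_{\mathbf k}\mathcal E_i)\in\mathcal D^G$ for $\rho\in\operatorname{irr}(H_i)$. Then the w-exceptional collection $$\bigl((F_{1,\rho})_{\rho\in\operatorname{irr}(H_1)},(F_{2,\rho})_{\rho\in\operatorname{irr}(H_2)},\dots,(F_{k,\rho})_{\rho\in\operatorname{irr}(H_k)}\bigr)$$ in $\mathcal D^G$ is full. If the collection $(\ast)$ is strong, then so is this induced collection.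
   Context: $\mathcal D$ cocomplete means arbitrary (set-indexed) direct sums exist; a dg-enhancement is a pretriangulated dg-category $\widehat{\mathcal D}$ over $\mathbf k$ with homotopy category $[\widehat{\mathcal D}]=\mathcal D$. $\mathcal D^c$ is the subcategory of compact objects ($F$ such that $\operatorname{Hom}(F,-)$ commutes with arbitrary direct sums). $\operatorname{Hom}^*(E,F)=\bigoplus_{n\in\mathbb Z}\operatorname{Hom}(E,F[n])$, $\operatorname{End}^*(E)=\operatorname{Hom}^*(E,E)$. Hom-finite means $\operatorname{Hom}^*(E,F)$ is finite-dimensional for all $E,F\in\mathcal D^c$. A $G$-action on $\mathcal D$ consists of autoequivalences $g_*\colon\mathcal D\to\mathcal D$ ($g\in G$) and isomorphisms of functors $\varepsilon_{g,h}\colon g_*\circ h_*\xrightarrow{\sim}(gh)_*$ satisfying the usual (associativity) compatibility condition. It lifts to the dg-enhancement if it is induced by an action of $G$ on $\widehat{\mathcal D}$ by dg-autoequivalences. The equivariant category $\mathcal D^G$ has objects $(E,\lambda)$ with $E\in\mathcal D$ and $\lambda=(\lambda_g\colon E\xrightarrow{\sim}g_*E)_{g\in G}$ satisfying $\varepsilon_{g,h}\circ g_*\lambda_h\circ\lambda_g=\lambda_{gh}$; $\operatorname{Hom}_{\mathcal D^G}((E,\lambda),(F,\mu))=\operatorname{Hom}_{\mathcal D}(E,F)^G$, the invariants under ${}^g\varphi=\mu_g^{-1}\circ g_*\varphi\circ\lambda_g$. Under these assumptions $\mathcal D^G$ is again a dg-enhanced cocomplete $\mathbf k$-linear triangulated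 category (direct sums, shifts and exact triangles being inherited from $\mathcal D$). For $H\le G$ the restriction functor $\operatorname{Res}_G^H\colon\mathcal D^G\to\mathcal D^H$, $(E,\lambda)\mapsto(E,\lambda|_H)$, has the induction functor $\operatorname{Ind}_H^G$ as left and right adjoint; the object underlying $\operatorname{Ind}_H^G(E)$ is $\bigoplus_{[g]\in G/H}g_*E$. Here $\mathcal D^1=\mathcal D$ for the trivial group $1$. $\operatorname{irr}(H)$ is the set of isomorphism classes of irreducible finite-dimensional right $\mathbf k$-representations of $H$; for such $(V,\rho)$ and $\mathcal E=(E,\lambda)\in\mathcal D^H$, $\rho\otimes_{\mathbf k}\mathcal E$ is $V\otimes_{\mathbf k}E\ (\cong E^{\oplus\dim V})$ with linearisation $\rho_g\otimes\lambda_g$. In a triangulated category of this kind: $E$ compact is weakly exceptional (w-exceptional) if $\operatorname{End}^*(E)$ is concentrated in degree $0$ and $\operatorname{End}(E)$ is a finite-dimensional division algebra over $\mathbf k$; exceptional if moreover $\operatorname{End}(E)=\mathbf k\cdot\operatorname{id}_E$. A sequence of (w-)exceptional objects is a (w-)exceptional collection if $\operatorname{Hom}^*(E,E')=0$ whenever $E$ comes strictly after $E'$; it is strong if $\operatorname{Hom}^*(E,E')$ is concentrated in degree $0$ for all members $E,E'$; it is full if the direct sum $C$ of its members is a compact generator, i.e. $C$ is compact and $\operatorname{Hom}^*(C,F)=0$ implies $F\cong0$. Within each block, the order of the $F_{i,\rho}$ is arbitrary. *)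

(* Defs.v *)
From HB Require Import structures.
From mathcomp Require Import all_boot all_algebra all_fingroup mxrepresentation.

Set Implicit Arguments.
Unset Strict Implicit.
Unset Printing Implicit Defensive.

Import GRing.Theory.
Local Open Scope ring_scope.

Record linCat (k : fieldType) := LinCat {
  obj :> Type;
  hom : obj -> obj -> lmodType k;
  idm : forall X, hom X X;
  cmp : forall X Y Z, hom Y Z -> hom X Y -> hom X Z;
  cmpA : forall W X Y Z (h : hom Y Z) (g : hom X Y) (f : hom W X),
    cmp h (cmp g f) = cmp (cmp h g) f;
  cmp1m : forall X Y (f : hom X Y), cmp (idm Y) f = f;
  cmpm1 : forall X Y (f : hom X Y), cmp f (idm X) = f;
  cmp_linl : forall X Y Z (f : hom X Y), linear (fun g : hom Y Z => cmp g f);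
  cmp_linr : forall X Y Z (g : hom Y Z), linear (fun f : hom X Y => cmp g f)
}.

Arguments hom {k l} X Y.
Arguments idm {k l} X.
Arguments cmp {k l X Y Z} g f.

Notation "g \oc f" := (cmp g f) (at level 40, left associativity).

Record iso (k : fieldType) (C : linCat k) (X Y : C) := Iso {
  fwd :> hom X Y;
  bwd : hom Y X;
  bwd_fwd : bwd \oc fwd = idm X;
  fwd_bwd : fwd \oc bwd = idm Y
}.

Definition isomorphic (k : fieldType) (C : linCat k) (X Y : C) : Prop :=
  inhabited (iso X Y).

Definition zero_object (k : fieldType) (C : linCat k) (Z : C) : Prop :=
  (forall X (f : hom X Z), f = 0) /\ (forall X (f : hom Z X), f = 0).

(* With [I] finite this is the (bi)product, as homs are additive. *)
Definition is_direct_sum (k : fieldType) (C : linCat k) (I : Type)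
    (X : I -> C) (S : C) (inj : forall i, hom (X i) S) : Prop :=
  forall (Y : C) (f : forall i, hom (X i) Y),
    exists! u : hom S Y, forall i, u \oc inj i = f i.

(* Index sets are small, i.e. they live in the universe of [choiceType], which
   is not required to contain the type of objects. *)
Definition cocomplete (k : fieldType) (C : linCat k) : Prop :=
  forall (I : choiceType) (X : I -> C),
    exists S (inj : forall i, hom (X i) S), is_direct_sum inj.

(* Bijectivity of the canonical map from the direct sum of the Hom(F, X i) to
   Hom(F, S), where S is the direct sum of the X i. *)
Definition compact (k : fieldType) (C : linCat k) (F : C) : Prop :=
  forall (I : choiceType) (X : I -> C) (S : C) (inj : forall i, hom (X i) S),
    is_direct_sum inj ->
    (forall f : hom F S, exists (s : seq I) (c : forall i, hom F (X i)),
        uniq s /\ f = \sum_(i <- s) inj i \oc c i) /\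
    (forall (s : seq I) (c : forall i, hom F (X i)),
        uniq s -> \sum_(i <- s) inj i \oc c i = 0 ->
        forall i, i \in s -> c i = 0).

Record linFunctor (k : fieldType) (C D : linCat k) := LinFunctor {
  fobj :> C -> D;
  fmap : forall X Y, hom X Y -> hom (fobj X) (fobj Y);
  fmap_lin : forall X Y, linear (@fmap X Y);
  fmap1 : forall X, fmap (idm X) = idm (fobj X);
  fmapM : forall X Y Z (g : hom Y Z) (f : hom X Y),
    fmap (g \oc f) = fmap g \oc fmap f
}.

Arguments fmap {k C D} l {X Y} f.

Definition fully_faithful (k : fieldType) (C D : linCat k)
    (F : linFunctor C D) : Prop :=
  forall X Y : C, bijective (fun f : hom X Y => fmap F f).

Definition equivalence (k : fieldType) (C D : linCat k)
    (F : linFunctor C D) : Prop :=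
  fully_faithful F /\ forall Y : D, exists X : C, isomorphic (F X) Y.

Lemma lin0 (k : fieldType) (U V : lmodType k) (f : U -> V) :
  linear f -> f 0 = 0.
Proof.
move=> lin_f; have := lin_f 1 0 0.
by rewrite !scale1r addr0 -[LHS]addr0 => /addrI.
Qed.

Lemma fmap_iso_bf (k : fieldType) (C D : linCat k) (F : linFunctor C D)
  (X Y : C) (f : iso X Y) : fmap F (bwd f) \oc fmap F f = idm (F X).
Proof. by rewrite -fmapM bwd_fwd fmap1. Qed.

Lemma fmap_iso_fb (k : fieldType) (C D : linCat k) (F : linFunctor C D)
  (X Y : C) (f : iso X Y) : fmap F f \oc fmap F (bwd f) = idm (F Y).
Proof. by rewrite -fmapM fwd_bwd fmap1. Qed.

Definition fmap_iso (k : fieldType) (C D : linCat k) (F : linFunctor C D)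
    (X Y : C) (f : iso X Y) : iso (F X) (F Y) :=
  Iso (fmap_iso_bf F f) (fmap_iso_fb F f).

Lemma inv_iso_subproof (k : fieldType) (C : linCat k) (X Y Z : C)
  (g : iso Y Z) (f : iso X Y) :
  (bwd f \oc bwd g) \oc (g \oc f) = idm X /\
  (g \oc f) \oc (bwd f \oc bwd g) = idm Z.
Proof.
split.
  by rewrite cmpA -(cmpA (bwd f)) bwd_fwd cmpm1 bwd_fwd.
by rewrite cmpA -(cmpA (fwd g)) fwd_bwd cmpm1 fwd_bwd.
Qed.

Definition inv_iso (k : fieldType) (C : linCat k) (X Y : C) (f : iso X Y) :
  iso Y X := Iso (fwd_bwd f) (bwd_fwd f).

Definition cmp_iso (k : fieldType) (C : linCat k) (X Y Z : C)
    (g : iso Y Z) (f : iso X Y) : iso X Z :=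
  Iso (proj1 (inv_iso_subproof g f)) (proj2 (inv_iso_subproof g f)).

(* Used with [M] a finite group (group actions) and with [M = int] (shifts).
   There is no separate isomorphism [act 1 ~= id]: it is determined by
   [aeps 1 1] as soon as the functors [act m] are equivalences. *)
Record catAction (M : Type) (op : M -> M -> M) (opA : associative op)
    (k : fieldType) (C : linCat k) := CatAction {
  act :> M -> linFunctor C C;
  aeps : forall m n X, iso (act m (act n X)) (act (op m n) X);
  aeps_nat : forall m n X Y (f : hom X Y),
    aeps m n Y \oc fmap (act m) (fmap (act n) f)
      = fmap (act (op m n)) f \oc aeps m n X;
  aeps_assoc : forall l m n X,
    ecast x (hom (act l (act m (act n X))) (act x X)) (opA l m n)
      (aeps l (op m n) X \oc fmap (act l) (aeps m n X))
      = aeps (op l m) n X \oc aeps l m (act n X)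
}.

Arguments aeps {M op opA k C} c m n X.

Definition by_equivalences (M : Type) (op : M -> M -> M)
    (opA : associative op) (k : fieldType) (C : linCat k)
    (a : catAction opA C) : Prop :=
  forall m, equivalence (a m).

Definition shiftAction (k : fieldType) (C : linCat k) : Type :=
  catAction (@addrA int) C.

Record triangCat (k : fieldType) := TriangCat {
  tcat :> linCat k;
  tsh : shiftAction tcat;
  tsh_equiv : by_equivalences tsh;
  has_zero : exists Z : tcat, zero_object Z;
  has_sums : forall (n : nat) (X : 'I_n -> tcat),
    exists S (inj : forall i, hom (X i) S), is_direct_sum inj;
  dist : forall X Y Z : tcat, hom X Y -> hom Y Z -> hom Z (tsh 1 X) -> Prop;
  dist_iso : forall (X Y Z X' Y' Z' : tcat)
    (f : hom X Y) (g : hom Y Z) (h : hom Z (tsh 1 X))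
    (f' : hom X' Y') (g' : hom Y' Z') (h' : hom Z' (tsh 1 X'))
    (a : iso X X') (b : iso Y Y') (c : iso Z Z'),
    b \oc f = f' \oc a -> c \oc g = g' \oc b ->
    fmap (tsh 1) a \oc h = h' \oc c ->
    dist f g h -> dist f' g' h';
  dist_id : forall X Z : tcat, zero_object Z ->
    dist (idm X) (0 : hom X Z) (0 : hom Z (tsh 1 X));
  dist_cone : forall (X Y : tcat) (f : hom X Y),
    exists (Z : tcat) (g : hom Y Z) (h : hom Z (tsh 1 X)), dist f g h;
  dist_rot : forall (X Y Z : tcat)
    (f : hom X Y) (g : hom Y Z) (h : hom Z (tsh 1 X)),
    dist f g h <-> dist g h (- fmap (tsh 1) f);
  dist_mor : forall (X Y Z X' Y' Z' : tcat)
    (f : hom X Y) (g : hom Y Z) (h : hom Z (tsh 1 X))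
    (f' : hom X' Y') (g' : hom Y' Z') (h' : hom Z' (tsh 1 X'))
    (a : hom X X') (b : hom Y Y'),
    dist f g h -> dist f' g' h' -> b \oc f = f' \oc a ->
    exists c : hom Z Z',
      c \oc g = g' \oc b /\ fmap (tsh 1) a \oc h = h' \oc c;
  dist_octahedron : forall (X Y Z X' Y' Z' : tcat)
    (f : hom X Y) (j : hom Y Z') (d : hom Z' (tsh 1 X))
    (g : hom Y Z) (l : hom Z X') (e : hom X' (tsh 1 Y))
    (m : hom Z Y') (n : hom Y' (tsh 1 X)),
    dist f j d -> dist g l e -> dist (g \oc f) m n ->
    exists (u : hom Z' Y') (v : hom Y' X'),
      [/\ dist u v (fmap (tsh 1) j \oc e),
          u \oc j = m \oc g, n \oc u = d, v \oc m = l
        & e \oc v = fmap (tsh 1) f \oc n]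
}.

Arguments tsh {k} t.
Arguments dist {k t X Y Z} f g h.

(* Action of a finite group by exact autoequivalences; [atheta] is the
   commutation of each [g] with the shifts. *)
Record gAction (k : fieldType) (gT : finGroupType) (D : triangCat k) :=
  GAction {
  gact :> catAction (@mulgA gT) D;
  gact_equiv : by_equivalences gact;
  atheta : forall g n X, iso (gact g (tsh D n X)) (tsh D n (gact g X));
  atheta_nat : forall g n X Y (f : hom X Y),
    atheta g n Y \oc fmap (gact g) (fmap (tsh D n) f)
      = fmap (tsh D n) (fmap (gact g) f) \oc atheta g n X;
  atheta_eps : forall g h n X,
    atheta (g * h)%g n X \oc aeps gact g h (tsh D n X)
      = fmap (tsh D n) (aeps gact g h X) \oc atheta g n (gact h X)
        \oc fmap (gact g) (atheta h n X);
  atheta_shift : forall g m n X,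
    atheta g (m + n) X \oc fmap (gact g) (aeps (tsh D) m n X)
      = aeps (tsh D) m n (gact g X) \oc fmap (tsh D m) (atheta g n X)
        \oc atheta g m (tsh D n X);
  gact_dist : forall g (X Y Z : D)
    (f : hom X Y) (f' : hom Y Z) (h : hom Z (tsh D 1 X)),
    dist f f' h ->
    dist (fmap (gact g) f) (fmap (gact g) f')
         (atheta g 1 X \oc fmap (gact g) h)
}.

Arguments atheta {k gT D} _ _ _ _.

Record subm (k : fieldType) (V : lmodType k) (P : submodClosed V) := Subm {
  submv :> V;
  submP : submv \in P
}.

HB.instance Definition _ (k : fieldType) (V : lmodType k)
  (P : submodClosed V) := [isSub for @submv k V P].
HB.instance Definition _ (k : fieldType) (V : lmodType k)
  (P : submodClosed V) := [Choice of subm P by <:].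
HB.instance Definition _ (k : fieldType) (V : lmodType k)
  (P : submodClosed V) := [SubChoice_isSubLmodule of subm P by <:].

Definition mk_submod (k : fieldType) (V : lmodType k) (P : {pred V})
    (hP : GRing.submod_closed P) : submodClosed V :=
  let Q : V -> bool := fun x => x \in P in
  HB.pack Q (GRing.isSubmodClosed.Build k V Q (GRing.submod_closed_semi hP)).

(* Objects over those of [C], homs a submodule of those of [C]. *)
Record subData (k : fieldType) (C : linCat k) := SubData {
  sobj : Type;
  sund : sobj -> C;
  shom : forall X Y, submodClosed (hom (sund X) (sund Y));
  shom1 : forall X, idm (sund X) \in shom X X;
  shomM : forall X Y Z (g : hom (sund Y) (sund Z)) (f : hom (sund X) (sund Y)),
    g \in shom Y Z -> f \in shom X Y -> g \oc f \in shom X Z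
}.

Section SubCat.

Context (k : fieldType) (C : linCat k) (S : subData C).

Definition sub_idm (X : sobj S) : subm (shom X X) := Subm (shom1 X).

Definition sub_cmp (X Y Z : sobj S) (g : subm (shom Y Z))
    (f : subm (shom X Y)) : subm (shom X Z) :=
  Subm (shomM (submP g) (submP f)).

Lemma sub_cmpA (W X Y Z : sobj S) (h : subm (shom Y Z)) (g : subm (shom X Y))
  (f : subm (shom W X)) :
  sub_cmp h (sub_cmp g f) = sub_cmp (sub_cmp h g) f.
Proof. by apply: val_inj; apply: cmpA. Qed.

Lemma sub_cmp1m (X Y : sobj S) (f : subm (shom X Y)) :
  sub_cmp (sub_idm Y) f = f.
Proof. by apply: val_inj; apply: cmp1m. Qed.

Lemma sub_cmpm1 (X Y : sobj S) (f : subm (shom X Y)) :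
  sub_cmp f (sub_idm X) = f.
Proof. by apply: val_inj; apply: cmpm1. Qed.

Lemma sub_linl (X Y Z : sobj S) (f : subm (shom X Y)) :
  linear (fun g : subm (shom Y Z) => sub_cmp g f).
Proof. by move=> a g g'; apply: val_inj; apply: cmp_linl. Qed.

Lemma sub_linr (X Y Z : sobj S) (g : subm (shom Y Z)) :
  linear (fun f : subm (shom X Y) => sub_cmp g f).
Proof. by move=> a f f'; apply: val_inj; apply: cmp_linr. Qed.

Definition subCat : linCat k :=
  LinCat sub_cmpA sub_cmp1m sub_cmpm1 sub_linl sub_linr.

End SubCat.

Section Equivariant.

Context (k : fieldType) (gT : finGroupType) (D : triangCat k).
Context (A : gAction gT D).

Record eqvObj (H : {group gT}) := EqvObj {
  eobj :> D;
  elin : forall g, g \in H -> iso eobj (A g eobj);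
  elin_cocycle : forall g h (gH : g \in H) (hH : h \in H)
      (ghH : (g * h)%g \in H),
    aeps A g h eobj \oc fmap (A g) (elin hH) \oc elin gH = elin ghH
}.

Definition conj_hom (H : {group gT}) (E F : eqvObj H) (g : gT) (gH : g \in H)
    (f : hom (eobj E) (eobj F)) : hom (eobj E) (eobj F) :=
  bwd (elin F gH) \oc fmap (A g) f \oc elin E gH.

Definition invariant (H : {group gT}) (E F : eqvObj H) :
    {pred hom (eobj E) (eobj F)} :=
  [pred f | [forall g : subg_of H, conj_hom (subgP g) f == f]].

Lemma invariantP (H : {group gT}) (E F : eqvObj H)
  (f : hom (eobj E) (eobj F)) :
  reflect (forall g (gH : g \in H),
             fmap (A g) f \oc elin E gH = elin F gH \oc f)
          (f \in @invariant H E F).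
Proof.
apply: (iffP forallP) => [inv_f g gH | eq_f [g gH]].
  have /eqP := inv_f (Subg gH).
  rewrite /conj_hom /= (bool_irrelevance (subgP (Subg gH)) gH) => {2}<-.
  by rewrite !cmpA fwd_bwd cmp1m.
apply/eqP; rewrite /conj_hom /=.
by rewrite -cmpA (eq_f g (subgP (Subg gH))) cmpA bwd_fwd cmp1m.
Qed.

Lemma invariant_submod (H : {group gT}) (E F : eqvObj H) :
  GRing.submod_closed (@invariant H E F).
Proof.
have lin a f f' : f \in @invariant H E F -> f' \in @invariant H E F ->
    a *: f + f' \in @invariant H E F.
  move=> /invariantP hf /invariantP hf'; apply/invariantP => g gH.
  by rewrite fmap_lin cmp_linl cmp_linr hf hf'.
split=> //; apply/invariantP => g gH.
by rewrite lin0 ?(lin0 (cmp_linl _)) ?(lin0 (cmp_linr _)) //; apply: fmap_lin.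
Qed.

Lemma invariant1 (H : {group gT}) (E : eqvObj H) :
  idm (eobj E) \in @invariant H E E.
Proof. by apply/invariantP => g gH; rewrite fmap1 cmp1m cmpm1. Qed.

Lemma invariantM (H : {group gT}) (X Y Z : eqvObj H)
  (g : hom (eobj Y) (eobj Z)) (f : hom (eobj X) (eobj Y)) :
  g \in @invariant H Y Z -> f \in @invariant H X Y ->
  g \oc f \in @invariant H X Z.
Proof.
move=> /invariantP hg /invariantP hf; apply/invariantP => x xH.
by rewrite fmapM -cmpA hf cmpA hg cmpA.
Qed.

Definition eqvData (H : {group gT}) : subData D :=
  @SubData k D (eqvObj H) (@eobj H)
    (fun E F => mk_submod (@invariant_submod H E F))
    (@invariant1 H) (@invariantM H).

(* The category D^H; D^G is the case [H := [set: gT]]. *)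
Definition eqvCat (H : {group gT}) : linCat k := subCat (eqvData H).

Definition eqv_sh_lin (H : {group gT}) (n : int) (E : eqvObj H) (g : gT)
    (gH : g \in H) : iso (tsh D n (eobj E)) (A g (tsh D n (eobj E))) :=
  cmp_iso (inv_iso (atheta A g n (eobj E))) (fmap_iso (tsh D n) (elin E gH)).

Lemma eqv_sh_cocycle (H : {group gT}) (n : int) (E : eqvObj H) g h
    (gH : g \in H) (hH : h \in H) (ghH : (g * h)%g \in H) :
  aeps A g h (tsh D n (eobj E)) \oc fmap (A g) (eqv_sh_lin n E hH)
    \oc eqv_sh_lin n E gH = eqv_sh_lin n E ghH.
Proof.
rewrite /= -(elin_cocycle E gH hH ghH) !fmapM !cmpA.
have can (X Y Z : D) (i : iso Y Z) (u v : hom X Y) : i \oc u = i \oc v -> u = v.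
  by move=> /(congr1 (fun w => bwd i \oc w)); rewrite !cmpA bwd_fwd !cmp1m.
apply: (can _ _ _ (atheta A (g * h)%g n (eobj E))).
rewrite !cmpA fwd_bwd cmp1m atheta_eps.
rewrite -(cmpA _ (fmap (A g) (atheta A h n _))) fmap_iso_fb cmpm1.
rewrite -(cmpA _ (atheta A g n _)) atheta_nat !cmpA.
by rewrite -(cmpA _ (atheta A g n _)) fwd_bwd cmpm1.
Qed.

Definition eqv_shobj (H : {group gT}) (n : int) (E : eqvCat H) : eqvCat H :=
  EqvObj (@eqv_sh_cocycle H n E).

Lemma eqv_sh_inv (H : {group gT}) (n : int) (E F : eqvCat H) (f : hom E F) :
  fmap (tsh D n) (submv f)
    \in @invariant H (eqv_shobj n E) (eqv_shobj n F).
Proof.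
apply/invariantP => g gH /=.
have /invariantP/(_ g gH) hf := submP f.
rewrite -cmpA -fmapM -hf fmapM !cmpA; congr (_ \oc _).
have := atheta_nat A g n (submv f) => /(congr1 (fun w => bwd (atheta A g n _)
  \oc w \oc bwd (atheta A g n _))).
by rewrite !cmpA bwd_fwd cmp1m -[RHS]cmpA fwd_bwd cmpm1.
Qed.

Definition eqv_shmap (H : {group gT}) (n : int) (E F : eqvCat H)
    (f : hom E F) : hom (eqv_shobj n E) (eqv_shobj n F) :=
  @Subm _ _ (@shom k D (eqvData H) (eqv_shobj n E) (eqv_shobj n F)) _
    (eqv_sh_inv n f).

Lemma eqv_shmap_lin (H : {group gT}) (n : int) (E F : eqvCat H) :
  linear (@eqv_shmap H n E F).
Proof. by move=> a f f'; apply: val_inj; apply: fmap_lin. Qed.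

Lemma eqv_shmap1 (H : {group gT}) (n : int) (E : eqvCat H) :
  eqv_shmap n (idm E) = idm (eqv_shobj n E).
Proof. by apply: val_inj; apply: fmap1. Qed.

Lemma eqv_shmapM (H : {group gT}) (n : int) (E F K : eqvCat H)
    (g : hom F K) (f : hom E F) :
  eqv_shmap n (g \oc f) = eqv_shmap n g \oc eqv_shmap n f.
Proof. by apply: val_inj; apply: fmapM. Qed.

Definition eqv_sh (H : {group gT}) (n : int) :
    linFunctor (eqvCat H) (eqvCat H) :=
  LinFunctor (@eqv_shmap_lin H n) (@eqv_shmap1 H n) (@eqv_shmapM H n).

Lemma res_cocycle (H K : {group gT}) (sKH : K \subset H) (E : eqvCat H) g h
    (gK : g \in K) (hK : h \in K) (ghK : (g * h)%g \in K) :
  aeps A g h (eobj E) \oc fmap (A g) (elin E (subsetP sKH h hK))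
    \oc elin E (subsetP sKH g gK) = elin E (subsetP sKH _ ghK).
Proof. exact: elin_cocycle. Qed.

Definition res_obj (H K : {group gT}) (sKH : K \subset H) (E : eqvCat H) :
    eqvCat K := EqvObj (@res_cocycle H K sKH E).

Lemma res_inv (H K : {group gT}) (sKH : K \subset H) (E F : eqvCat H)
    (f : hom E F) :
  submv f \in @invariant K (res_obj sKH E) (res_obj sKH F).
Proof.
by apply/invariantP => g gK; have /invariantP := submP f; apply.
Qed.

Definition res_map (H K : {group gT}) (sKH : K \subset H) (E F : eqvCat H)
    (f : hom E F) : hom (res_obj sKH E) (res_obj sKH F) :=
  @Subm _ _ (@shom k D (eqvData K) (res_obj sKH E) (res_obj sKH F)) _
    (res_inv sKH f).

Lemma res_map_lin (H K : {group gT}) (sKH : K \subset H) (E F : eqvCat H) :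
  linear (@res_map H K sKH E F).
Proof. by move=> a f f'; apply: val_inj. Qed.

Lemma res_map1 (H K : {group gT}) (sKH : K \subset H) (E : eqvCat H) :
  res_map sKH (idm E) = idm (res_obj sKH E).
Proof. exact: val_inj. Qed.

Lemma res_mapM (H K : {group gT}) (sKH : K \subset H) (E F M : eqvCat H)
    (g : hom F M) (f : hom E F) :
  res_map sKH (g \oc f) = res_map sKH g \oc res_map sKH f.
Proof. exact: val_inj. Qed.

Definition Res (H K : {group gT}) (sKH : K \subset H) :
    linFunctor (eqvCat H) (eqvCat K) :=
  LinFunctor (@res_map_lin H K sKH) (@res_map1 H K sKH) (@res_mapM H K sKH).

(* [F] is Ind_H^G [X]: the value at [X] of the left adjoint of Res, given by a
   universal arrow. *)
Definition is_induced (H : {group gT}) (X : eqvCat H)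
    (F : eqvCat [set: gT]%G) : Prop :=
  exists u : hom X (Res (subsetT H) F),
    forall Y : eqvCat [set: gT]%G,
      bijective (fun f : hom F Y => fmap (Res (subsetT H)) f \oc u).

(* [X] is rho (x) [E], for the right representation rho of [H] on row vectors
   'rV_n: the underlying object is the sum of copies of [E] indexed by the
   canonical basis, and e_i *m rho g = \sum_j rho g i j *: e_j. *)
Definition is_rep_tensor (H : {group gT}) (n : nat)
    (rho : mx_representation k H n) (E X : eqvCat H) : Prop :=
  exists inj : forall i : 'I_n, hom (eobj E) (eobj X),
    is_direct_sum inj /\
    forall g (gH : g \in H) (i : 'I_n),
      elin X gH \oc inj i
        = \sum_j rho g i j *: (fmap (A g) (inj j) \oc elin E gH).

End Equivariant.

Arguments eqv_sh {k gT D} A H n.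

(* A linear category with functors [n], the structure in which Hom^* makes
   sense. *)
Record shCat (k : fieldType) := ShCat {
  shcat :> linCat k;
  shf : int -> linFunctor shcat shcat
}.

Arguments shf {k} s n.

Definition tri_shCat (k : fieldType) (D : triangCat k) : shCat k :=
  ShCat (tsh D).

Definition eqv_shCat (k : fieldType) (gT : finGroupType) (D : triangCat k)
    (A : gAction gT D) (H : {group gT}) : shCat k :=
  ShCat (eqv_sh A H).

Section Exceptional.

Context (k : fieldType) (C : shCat k).

Definition fin_dim (V : lmodType k) : Prop :=
  exists (n : nat) (v : 'I_n -> V),
    forall x, exists c : 'I_n -> k, x = \sum_i c i *: v i.

Definition hom_star_zero (E F : C) : Prop :=
  forall (n : int) (f : hom E (shf C n F)), f = 0.

Definition hom_star_deg0 (E F : C) : Prop :=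
  forall (n : int), n != 0 -> forall f : hom E (shf C n F), f = 0.

(* Finite dimension of the direct sum over [n] of the Hom(E, F[n]). *)
Definition hom_star_fin_dim (E F : C) : Prop :=
  (exists s : seq int,
     forall n, n \notin s -> forall f : hom E (shf C n F), f = 0) /\
  (forall n, fin_dim (hom E (shf C n F))).

Definition hom_finite : Prop :=
  forall E F : C, compact E -> compact F -> hom_star_fin_dim E F.

Definition end_division (E : C) : Prop :=
  idm E != 0 /\
  forall f : hom E E, f != 0 ->
    exists g : hom E E, g \oc f = idm E /\ f \oc g = idm E.

Definition w_exceptional (E : C) : Prop :=
  [/\ compact E, hom_star_deg0 E E, fin_dim (hom E E) & end_division E].

Definition exceptional (E : C) : Prop :=
  w_exceptional E /\ forall f : hom E E, exists c : k, f = c *: idm E.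

(* Sequences are families indexed by a finite type with a strict order. *)
Definition w_exceptional_collection (I : finType) (lt : rel I) (E : I -> C) :
    Prop :=
  (forall i, w_exceptional (E i)) /\
  (forall i j, lt i j -> hom_star_zero (E j) (E i)).

Definition exceptional_collection (I : finType) (lt : rel I) (E : I -> C) :
    Prop :=
  (forall i, exceptional (E i)) /\
  (forall i j, lt i j -> hom_star_zero (E j) (E i)).

Definition strong (I : finType) (E : I -> C) : Prop :=
  forall i j, hom_star_deg0 (E i) (E j).

Definition compact_generator (S : C) : Prop :=
  compact S /\ forall F : C, hom_star_zero S F -> zero_object F.

Definition full (I : finType) (E : I -> C) : Prop :=
  exists S (inj : forall i, hom (E i) S),
    is_direct_sum inj /\ compact_generator S.

End Exceptional.

(* Lexicographic order on the indices of a sequence made of [m] consecutive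
   blocks, the [i]-th of length [l i]. *)
Definition block_lt (m : nat) (l : 'I_m -> nat) :
    rel {i : 'I_m & 'I_(l i)} :=
  fun x y => (tag x < tag y)%N ||
    ((tag x == tag y) && (tagged x < tagged y)%N).

Record leftAction (gT : finGroupType) (T : finType) := LeftAction {
  lact :> gT -> T -> T;
  lact1 : forall x, lact 1%g x = x;
  lactM : forall g h x, lact (g * h)%g x = lact g (lact h x)
}.

Definition transitive_action (gT : finGroupType) (T : finType)
    (a : leftAction gT T) : Prop :=
  forall x y, exists g, a g x = y.

Lemma stabiliser_group_set (gT : finGroupType) (T : finType)
  (a : leftAction gT T) (x : T) : group_set [set g | a g x == x].
Proof.
apply/group_setP; split=> [|g h]; rewrite !inE ?lact1 // => /eqP gx /eqP hx.
by rewrite lactM hx gx.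
Qed.

Definition stabiliser (gT : finGroupType) (T : finType)
    (a : leftAction gT T) (x : T) : {group gT} :=
  Group (stabiliser_group_set a x).

(* [rho] enumerates irr(H): every irreducible representation of [H] over [k] is
   isomorphic to exactly one [rho s]. *)
Definition enumerates_irr (k : fieldType) (gT : finGroupType)
    (H : {group gT}) (r : nat) (d : 'I_r -> nat)
    (rho : forall s, mx_representation k H (d s)) : Prop :=
  [/\ forall s, mx_irreducible (rho s),
      forall s t, mx_rsim (rho s) (rho t) -> s = t
    & forall n (sg : mx_representation k H n), mx_irreducible sg ->
        exists s, mx_rsim sg (rho s)].

(* The complex Hom(X, Y) is represented by its total module, with [deg n] the
   submodule of elements of degree [n]. *)
Record dgCat (k : fieldType) := DgCat {
  dcat :> linCat k;
  deg : forall X Y : dcat, int -> {pred hom X Y};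
  deg_submod : forall (X Y : dcat) n, GRing.submod_closed (@deg X Y n);
  deg_span : forall (X Y : dcat) (f : hom X Y),
    exists (s : seq int) (c : int -> hom X Y),
      [/\ uniq s, forall n, c n \in deg n & f = \sum_(n <- s) c n];
  deg_free : forall (X Y : dcat) (s : seq int) (c : int -> hom X Y),
    uniq s -> (forall n, c n \in deg n) -> \sum_(n <- s) c n = 0 ->
    forall n, n \in s -> c n = 0;
  deg_idm : forall X : dcat, idm X \in deg 0;
  deg_cmp : forall (X Y Z : dcat) m n (g : hom Y Z) (f : hom X Y),
    g \in deg m -> f \in deg n -> g \oc f \in deg (m + n);
  diff : forall X Y : dcat, hom X Y -> hom X Y;
  diff_lin : forall X Y : dcat, linear (@diff X Y);
  diff_deg : forall (X Y : dcat) n (f : hom X Y),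
    f \in deg n -> diff f \in deg (n + 1);
  diff_diff : forall (X Y : dcat) (f : hom X Y), diff (diff f) = 0;
  diff_cmp : forall (X Y Z : dcat) (m : int) (g : hom Y Z) (f : hom X Y),
    g \in deg m ->
    diff (g \oc f) = diff g \oc f + ((-1 : k) ^ m) *: (g \oc diff f)
}.

Arguments deg {k d X Y} n.
Arguments diff {k d X Y} f.

Section Dg.

Context (k : fieldType) (B : dgCat k).

Definition homotopic (X Y : B) (f g : hom X Y) : Prop :=
  exists h, f - g = diff h.

Definition closed0 (X Y : B) : {pred hom X Y} :=
  [pred f | (f \in deg 0) && (diff f == 0)].

Lemma closed0_submod (X Y : B) : GRing.submod_closed (@closed0 X Y).
Proof.
have [deg00 degL] := @deg_submod k B X Y 0.
split; first by rewrite inE deg00 (lin0 (@diff_lin _ _ _ _)) eqxx.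
move=> a f g /andP[f0 /eqP df] /andP[g0 /eqP dg]; rewrite inE degL //=.
by rewrite diff_lin df dg scaler0 addr0.
Qed.

Lemma closed0_idm (X : B) : idm X \in @closed0 X X.
Proof.
rewrite inE deg_idm /=; apply/eqP.
have := diff_cmp (idm X) (deg_idm X).
by rewrite expr0z scale1r cmp1m cmpm1 cmp1m -[LHS]addr0 => /addrI.
Qed.

Lemma closed0_cmp (X Y Z : B) (g : hom Y Z) (f : hom X Y) :
  g \in @closed0 Y Z -> f \in @closed0 X Y -> g \oc f \in @closed0 X Z.
Proof.
move=> /andP[g0 /eqP dg] /andP[f0 /eqP df]; rewrite inE.
rewrite -[0 : int]addr0 deg_cmp //= (diff_cmp f g0) dg df.
by rewrite (lin0 (cmp_linl _)) (lin0 (cmp_linr _)) scaler0 addr0 eqxx.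
Qed.

Definition Z0Data : subData B :=
  @SubData k B B id (fun X Y => mk_submod (@closed0_submod X Y))
    closed0_idm closed0_cmp.

Definition Z0 : linCat k := subCat Z0Data.

Definition mkZ0 (X Y : B) (f : hom X Y) (hf : f \in @closed0 X Y) :
    hom (X : Z0) (Y : Z0) :=
  @Subm _ _ (@shom k B Z0Data X Y) f hf.

(* [sg] exhibits [Y] as X[n] up to homotopy equivalence. *)
Definition is_shift (n : int) (X Y : B) (sg : hom X Y) : Prop :=
  [/\ sg \in deg (- n), diff sg = 0
    & exists t : hom Y X,
        [/\ t \in deg n, diff t = 0, homotopic (t \oc sg) (idm X)
          & homotopic (sg \oc t) (idm Y)]].

(* [(s, j)] defines a morphism from the cone of Hom(-, f), i.e. from
   Hom(-, X)[1] (+) Hom(-, Y) with differential (a, b) |-> (- da, db + f a), to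
   Hom(-, Z); it is required to be a quasi-isomorphism. *)
Definition is_cone (X Y Z : B) (f : hom X Y) (j : hom Y Z) (s : hom X Z) :
    Prop :=
  [/\ j \in @closed0 Y Z, s \in deg (- 1), diff s = j \oc f
    & forall W : B,
      (forall (a : hom W X) (b : hom W Y) (c : hom W Z),
         diff a = 0 -> diff b + f \oc a = 0 -> s \oc a + j \oc b = diff c ->
         exists (a' : hom W X) (b' : hom W Y),
           a = - diff a' /\ b = diff b' + f \oc a') /\
      (forall z : hom W Z, diff z = 0 ->
         exists (a : hom W X) (b : hom W Y),
           [/\ diff a = 0, diff b + f \oc a = 0
             & homotopic z (s \oc a + j \oc b)])].

Definition pretriangulated : Prop :=
  (forall (X : B) (n : int), exists (Y : B) (sg : hom X Y), is_shift n sg) /\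
  (forall (X Y : B) (f : hom X Y), f \in @closed0 X Y ->
     exists (Z : B) (j : hom Y Z) (s : hom X Z), is_cone f j s).

(* X -f-> Y -j-> Z -p-> X, with [p] closed of degree 1, is a standard triangle:
   [Z] is a cone of [f] and, up to the homotopy [(v, u)], [p] corresponds to the
   projection of the cone onto Hom(-, X)[1]. *)
Definition cone_triangle (X Y Z : B) (f : hom X Y) (j : hom Y Z)
    (p : hom Z X) : Prop :=
  [/\ p \in deg 1, diff p = 0
    & exists (s : hom X Z) (u : hom Y X) (v : hom X X),
        [/\ is_cone f j s, u \in deg 0, p \oc j = diff u
          & p \oc s + u \oc f = idm X + diff v]].

End Dg.

(* [enhF] induces an equivalence from the homotopy category of [enhB] to [D];
   [enhsh] is its compatibility with the shifts. *)
Record dgEnhancement (k : fieldType) (D : triangCat k) := DgEnhancement {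
  enhB :> dgCat k;
  enh_pretri : pretriangulated enhB;
  enhF : linFunctor (Z0 enhB) D;
  enhF_full : forall (X Y : Z0 enhB) (f : hom (enhF X) (enhF Y)),
    exists f' : hom X Y, fmap enhF f' = f;
  enhF_ker : forall (X Y : Z0 enhB) (f : hom X Y),
    fmap enhF f = 0 <-> homotopic (submv f) 0;
  enhF_surj : forall Y : D, exists X : Z0 enhB, isomorphic (enhF X) Y;
  enhsh : forall n (X Y : enhB) (sg : hom X Y),
    is_shift n sg -> iso (enhF Y) (tsh D n (enhF X));
  enhsh_nat : forall n (X Y X' Y' : enhB) (sg : hom X Y) (sg' : hom X' Y')
    (hsg : is_shift n sg) (hsg' : is_shift n sg')
    (f : hom (X : Z0 enhB) (X' : Z0 enhB))
    (f' : hom (Y : Z0 enhB) (Y' : Z0 enhB)),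
    homotopic (submv f' \oc sg) (sg' \oc submv f) ->
    enhsh hsg' \oc fmap enhF f' = fmap (tsh D n) (fmap enhF f) \oc enhsh hsg;
  enhsh_cmp : forall m n (X Y Z : enhB) (sg : hom X Y) (sg' : hom Y Z)
    (hsg : is_shift n sg) (hsg' : is_shift m sg')
    (hc : is_shift (m + n) (sg' \oc sg)),
    (enhsh hc : hom _ _)
      = aeps (tsh D) m n (enhF X) \oc fmap (tsh D m) (enhsh hsg)
        \oc enhsh hsg';
  enh_dist : forall (X Y Z X1 : enhB)
    (f : hom (X : Z0 enhB) (Y : Z0 enhB)) (j : hom (Y : Z0 enhB) (Z : Z0 enhB))
    (p : hom Z X) (sg : hom X X1) (hsg : is_shift 1 sg)
    (q : hom (Z : Z0 enhB) (X1 : Z0 enhB)),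
    cone_triangle (submv f) (submv j) p -> submv q = sg \oc p ->
    dist (fmap enhF f) (fmap enhF j) (enhsh hsg \oc fmap enhF q)
}.

Arguments enhF {k D} _.
Arguments enhsh {k D} _ {n X Y sg} _.

Record dgAction (k : fieldType) (gT : finGroupType) (B : dgCat k) := DgAction {
  dgact :> catAction (@mulgA gT) B;
  dgact_deg : forall g (X Y : B) n (f : hom X Y),
    f \in deg n -> fmap (dgact g) f \in deg n;
  dgact_diff : forall g (X Y : B) (f : hom X Y),
    fmap (dgact g) (diff f) = diff (fmap (dgact g) f);
  dgact_eps : forall g h (X : B),
    (aeps dgact g h X : hom _ _) \in @closed0 k B _ _;
  dgact_ff : forall g, fully_faithful (dgact g);
  dgact_surj : forall g (Y : B), exists (X : B) (i : iso (dgact g X) Y),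
    (i : hom _ _) \in @closed0 k B _ _
}.

Section DgActionZ0.

Context (k : fieldType) (gT : finGroupType) (B : dgCat k) (a : dgAction gT B).

Lemma dgact_closed0 g (X Y : B) (f : hom (X : Z0 B) (Y : Z0 B)) :
  fmap (a g) (submv f) \in @closed0 k B _ _.
Proof.
have /andP[f0 /eqP df] := submP f.
by rewrite inE dgact_deg //= -dgact_diff df (lin0 (@fmap_lin _ _ _ _ _ _)).
Qed.

Definition dgactZ0 g (X Y : B) (f : hom (X : Z0 B) (Y : Z0 B)) :
    hom (a g X : Z0 B) (a g Y : Z0 B) :=
  mkZ0 (dgact_closed0 g f).

Definition dgepsZ0 g h (X : B) :
    hom (a g (a h X) : Z0 B) (a (g * h)%g X : Z0 B) :=
  mkZ0 (dgact_eps a g h X).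

End DgActionZ0.

(* The action [A] is induced, through the enhancement, by an action on the
   dg-category. *)
Record dgLift (k : fieldType) (gT : finGroupType) (D : triangCat k)
    (A : gAction gT D) (B : dgEnhancement D) := DgLift {
  lifta :> dgAction gT B;
  lifti : forall g (X : B), iso (enhF B (lifta g X)) (A g (enhF B X));
  lifti_nat : forall g (X Y : B) (f : hom (X : Z0 B) (Y : Z0 B)),
    lifti g Y \oc fmap (enhF B) (dgactZ0 lifta g f)
      = fmap (A g) (fmap (enhF B) f) \oc lifti g X;
  lifti_eps : forall g h (X : B),
    lifti (g * h)%g X \oc fmap (enhF B) (dgepsZ0 lifta g h X)
      = aeps A g h (enhF B X) \oc fmap (A g) (lifti h X)
        \oc lifti g (lifta h X);
  lifti_sh : forall g n (X Y : B) (sg : hom X Y) (hsg : is_shift n sg)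
    (hgsg : is_shift n (fmap (lifta g) sg)),
    atheta A g n (enhF B X) \oc fmap (A g) (enhsh B hsg) \oc lifti g Y
      = fmap (tsh D n) (lifti g X) \oc enhsh B hgsg
}.

(* Main.v *)
(* Write E for the object of D^H given by E_{i,1}, X = rho (x) E and F = Ind X,
   defined by the universal arrow u : X -> Res F. Composition with the
   components v_j : E -> F of u identifies Hom(F, Y) with the H-equivariant maps
   from rho to Hom_D(E, Y).

   As #|H| is invertible in k, F is a direct summand of the sum of the g_* X,
   so the vanishing of Hom^* between the E_{i,j} in the relevant order
   passes to the F's, and a morphism E -> F factors through u because Hom(E,
   g_* E) = 0 for g outside H. Since End E = k, the morphisms between two F's
   of the same block are the intertwiners of the representations, and Schur's
   lemma gives the division algebras and the vanishing for distinct
   representations.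

   If Hom^*(F_{i,rho}, Y) = 0 for all rho, then a vector of Hom(E, Y[n])
   generates a quotient of the regular representation of H, whose irreducible
   summands all map to 0 (Maschke); hence Hom(E, Y[n]) = 0. By transitivity and
   the linearisation of Y, Hom^*(E_{i,j}, Y) = 0 for all i and j, so Y = 0. *)

From mathcomp Require Import all_boot all_algebra all_fingroup mxrepresentation.
Require Import Defs.

Set Implicit Arguments.
Unset Strict Implicit.
Unset Printing Implicit Defensive.

Import GRing.Theory.
Local Open Scope ring_scope.

(** * Linear categories and direct sums *)

Section LinCat.

Context (k : fieldType) (C : linCat k).

Lemma cmp0m (X Y Z : C) (f : hom X Y) : (0 : hom Y Z) \oc f = 0.
Proof. exact: (lin0 (cmp_linl f)). Qed.

Lemma cmpm0 (X Y Z : C) (g : hom Y Z) : g \oc (0 : hom X Y) = 0.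
Proof. exact: (lin0 (cmp_linr g)). Qed.

Lemma cmpDm (X Y Z : C) (f : hom X Y) (g h : hom Y Z) :
  (g + h) \oc f = g \oc f + h \oc f.
Proof. by have := cmp_linl f 1 g h; rewrite !scale1r. Qed.

Lemma cmpmD (X Y Z : C) (f g : hom X Y) (h : hom Y Z) :
  h \oc (f + g) = h \oc f + h \oc g.
Proof. by have := cmp_linr h 1 f g; rewrite !scale1r. Qed.

Lemma cmpZm (X Y Z : C) (f : hom X Y) c (g : hom Y Z) :
  (c *: g) \oc f = c *: (g \oc f).
Proof. by have := cmp_linl f c g 0; rewrite cmp0m !addr0. Qed.

Lemma cmpmZ (X Y Z : C) c (f : hom X Y) (g : hom Y Z) :
  g \oc (c *: f) = c *: (g \oc f).
Proof. by have := cmp_linr g c f 0; rewrite cmpm0 !addr0. Qed.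

Lemma cmp_suml (X Y Z : C) (f : hom X Y) I (r : seq I) (P : pred I)
    (g : I -> hom Y Z) :
  (\sum_(i <- r | P i) g i) \oc f = \sum_(i <- r | P i) g i \oc f.
Proof.
exact: (big_morph (fun x : hom Y Z => x \oc f) (cmpDm f) (cmp0m _ f)).
Qed.

Lemma cmp_sumr (X Y Z : C) (g : hom Y Z) I (r : seq I) (P : pred I)
    (f : I -> hom X Y) :
  g \oc (\sum_(i <- r | P i) f i) = \sum_(i <- r | P i) g \oc f i.
Proof.
exact: (big_morph (fun x : hom X Y => g \oc x) (fun a b => cmpmD a b g)
  (cmpm0 _ g)).
Qed.

Lemma cmp_bwdK (X Y Z : C) (e : iso Y Z) (f : hom X Y) :
  bwd e \oc (e \oc f) = f.
Proof. by rewrite cmpA bwd_fwd cmp1m. Qed.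

Lemma cmp_fwdK (X Y Z : C) (e : iso Y Z) (f : hom X Z) :
  e \oc (bwd e \oc f) = f.
Proof. by rewrite cmpA fwd_bwd cmp1m. Qed.

Lemma iso_monic (X Y Z : C) (e : iso Y Z) (f g : hom X Y) :
  e \oc f = e \oc g -> f = g.
Proof. by move=> efg; rewrite -(cmp_bwdK e f) efg cmp_bwdK. Qed.

Lemma iso_epic (X Y Z : C) (e : iso X Y) (f g : hom Y Z) :
  f \oc e = g \oc e -> f = g.
Proof.
move=> fge; rewrite -(cmpm1 f) -(cmpm1 g) -(fwd_bwd e) !cmpA.
by rewrite fge.
Qed.

Lemma hom_zero_iso (X Y X' Y' : C) (e : iso X X') (e' : iso Y Y') :
  (forall f : hom X' Y', f = 0) -> forall f : hom X Y, f = 0.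
Proof.
move=> z f; apply: (iso_monic (e := e')); rewrite cmpm0.
by rewrite -[LHS]cmpm1 -(bwd_fwd e) cmpA (z (_ \oc bwd e)) cmp0m.
Qed.

End LinCat.

Section LinFunctor.

Context (k : fieldType) (C D : linCat k) (F : linFunctor C D).

Lemma fmap0 (X Y : C) : fmap F (0 : hom X Y) = 0.
Proof. exact: (lin0 (@fmap_lin _ _ _ F X Y)). Qed.

Lemma fmapD (X Y : C) (f g : hom X Y) : fmap F (f + g) = fmap F f + fmap F g.
Proof. by have := fmap_lin F 1 f g; rewrite !scale1r. Qed.

Lemma fmapZ (X Y : C) c (f : hom X Y) : fmap F (c *: f) = c *: fmap F f.
Proof. by have := fmap_lin F c f 0; rewrite fmap0 !addr0. Qed.

Lemma fmap_sum (X Y : C) I (r : seq I) (P : pred I) (f : I -> hom X Y) :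
  fmap F (\sum_(i <- r | P i) f i) = \sum_(i <- r | P i) fmap F (f i).
Proof. exact: (big_morph (@fmap _ _ _ F X Y) (@fmapD X Y) (@fmap0 X Y)). Qed.

Lemma full_of_ff (X Y : C) : fully_faithful F ->
  forall f : hom (F X) (F Y), exists f', fmap F f' = f.
Proof. by move=> /(_ X Y) [h _ hK] f; exists (h f). Qed.

Lemma faithful_of_ff (X Y : C) : fully_faithful F ->
  injective (@fmap _ _ _ F X Y).
Proof. by move=> /(_ X Y) /bij_inj. Qed.

End LinFunctor.

Section DirectSums.

Context (k : fieldType).

Section OneCategory.

Context (C : linCat k) (I : Type) (X : I -> C) (S : C).
Context (inj : forall i, hom (X i) S).
Hypothesis dS : is_direct_sum inj.

Lemma dsum_ext (Y : C) (f g : hom S Y) :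
  (forall i, f \oc inj i = g \oc inj i) -> f = g.
Proof.
by move=> fg; have [h [_ uh]] := dS (fun i => g \oc inj i);
  rewrite -(uh f fg) -(uh g).
Qed.

Lemma dsum_desc (Y : C) (f : forall i, hom (X i) Y) :
  exists u : hom S Y, forall i, u \oc inj i = f i.
Proof. by have [u [uf _]] := dS f; exists u. Qed.

Lemma is_direct_sum_iso (X' : I -> C) (S' : C) (inj' : forall i, hom (X' i) S')
    (e : iso S S') (a : forall i, iso (X i) (X' i)) :
  (forall i, e \oc inj i = inj' i \oc a i) -> is_direct_sum inj'.
Proof.
move=> eq_e Y f; have [u [uf uu]] := dS (fun i => f i \oc a i).
exists (u \oc bwd e); split=> [i | u' u'f].
  apply: (iso_epic (e := a i)).
  by rewrite -cmpA -eq_e -cmpA cmp_bwdK.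
rewrite (uu (u' \oc e)) -?cmpA ?fwd_bwd ?cmpm1 // => i.
by rewrite -cmpA eq_e cmpA u'f.
Qed.

End OneCategory.

Lemma dsum_iso (C : linCat k) (I : Type) (X X' : I -> C) (S S' : C)
    (inj : forall i, hom (X i) S) (inj' : forall i, hom (X' i) S')
    (dS : is_direct_sum inj) (dS' : is_direct_sum inj')
    (a : forall i, iso (X i) (X' i)) :
  exists e : iso S S', forall i, e \oc inj i = inj' i \oc a i.
Proof.
have [u uE] := dsum_desc dS (fun i => inj' i \oc a i).
have [v vE] := dsum_desc dS' (fun i => inj i \oc bwd (a i)).
have vu : v \oc u = idm S.
  apply: (dsum_ext dS) => i.
  by rewrite -cmpA uE cmpA vE -cmpA bwd_fwd cmpm1 cmp1m.
have uv : u \oc v = idm S'.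
  apply: (dsum_ext dS') => i.
  by rewrite -cmpA vE cmpA uE -cmpA fwd_bwd cmpm1 cmp1m.
by exists (Iso vu uv).
Qed.

(** Essential surjectivity replaces the target [Y] by some [F Z]; full faithfulness then carries the
    universal property over. *)
Lemma equivalence_dsum (C D : linCat k) (F : linFunctor C D) (I : Type)
    (X : I -> C) (S : C) (inj : forall i, hom (X i) S) :
  equivalence F -> is_direct_sum inj ->
  is_direct_sum (fun i => fmap F (inj i)).
Proof.
move=> [Fff Fsurj] dS Y f; have [Z [e]] := Fsurj Y.
have [h hE]: exists h : forall i, hom (X i) Z,
    forall i, fmap F (h i) = bwd e \oc f i.
  (* [I] may be infinite, so the preimages are picked with [xchoose], homs being choice types. *)
  have ex i : exists h, fmap F h == bwd e \oc f i.
    by have [h <-] := full_of_ff Fff (bwd e \oc f i); exists h.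
  by exists (fun i => xchoose (ex i)) => i; apply/eqP/(xchooseP (ex i)).
have [u uh] := dsum_desc dS h.
exists (e \oc fmap F u); split=> [i | u' u'f].
  by rewrite -cmpA -fmapM uh hE cmp_fwdK.
have [u1 u1E] := full_of_ff Fff (bwd e \oc u').
suff -> : u = u1 by rewrite u1E cmp_fwdK.
apply: (dsum_ext dS) => i; apply: (faithful_of_ff Fff).
by rewrite uh hE fmapM u1E -cmpA u'f.
Qed.

Lemma dsum_reindex (C : linCat k) (I J : eqType) (h : J -> I) (X : I -> C)
    (S : C) (inj : forall i, hom (X i) S) :
  bijective h -> is_direct_sum inj -> is_direct_sum (fun j => inj (h j)).
Proof.
move=> [h' hK h'K] dS Y f.
(* The component at [h' i] lives over [h (h' i)], hence the cast; at [i = h j] it runs along a loop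
   and disappears by uniqueness of identity proofs. *)
pose f' i : hom (X i) Y := ecast i (hom (X i) Y) (h'K i) (f (h' i)).
have f'E j : f' (h j) = f j.
  rewrite /f'; move: (h'K (h j)); rewrite hK => e.
  by rewrite eq_axiomK.
have [u [uf uu]] := dS _ f'; exists u; split=> [j | v vf].
  by rewrite uf f'E.
by apply: uu => i; rewrite -(h'K i) vf f'E.
Qed.

Lemma dsum_proj (C : linCat k) (I : finType) (X : I -> C) (S : C)
    (inj : forall i, hom (X i) S) :
  is_direct_sum inj ->
  exists pr : forall i, hom S (X i),
    [/\ forall i, pr i \oc inj i = idm (X i),
        forall i j, i != j -> pr i \oc inj j = 0
      & \sum_i inj i \oc pr i = idm S].
Proof.
move=> dS.
(* A Kronecker delta, cast because source and target carry different indices. *)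
pose del i j : hom (X j) (X i) :=
  if j =P i is ReflectT e then ecast i (hom (X j) (X i)) e (idm (X j)) else 0.
have delii i : del i i = idm (X i).
  by rewrite /del; case: eqP => // e; rewrite eq_axiomK.
have delij i j : i != j -> del i j = 0.
  by rewrite /del eq_sym; case: eqP.
have [pr prE]: exists pr : forall i, hom S (X i),
    forall i j, pr i \oc inj j = del i j.
  by apply: (fin_all_exists (P := fun i p => forall j, p \oc inj j = del i j))
    => i; apply: dsum_desc.
exists pr; split=> [i | i j ij |]; rewrite ?prE ?delii ?delij //.
apply: (dsum_ext dS) => j; rewrite cmp_suml cmp1m (bigD1 j) //= big1.
  by rewrite -cmpA prE delii cmpm1 addr0.
by move=> i ij; rewrite -cmpA prE delij // cmpm0.
Qed.

Lemma compact_dsum (C : linCat k) (J : finType) (X : J -> C) (S : C)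
    (inj : forall j, hom (X j) S) :
  is_direct_sum inj -> (forall j, compact (X j)) -> compact S.
Proof.
move=> dS cX I Y T inT dT; have [pr [_ _ pr_sum]] := dsum_proj dS.
split=> [f | s c us c0 i si].
  have [s sP]: exists s : J -> seq I, forall j, exists c,
      uniq (s j) /\ f \oc inj j = \sum_(i <- s j) inT i \oc c i.
    apply: (fin_all_exists (P := fun j s =>
      exists c : forall i, hom (X j) (Y i),
        uniq s /\ f \oc inj j = \sum_(i <- s) inT i \oc c i)) => j.
    by have [fP _] := cX j I Y T inT dT; apply: fP.
  have [c cP] := fin_all_exists sP.
  (* [s'] is the union of the supports; [c'] sets to zero the coefficients outside [s j], which [cP]
     leaves arbitrary. *)
  pose s' := undup (flatten [seq s j | j <- enum J]).
  pose c' j i := if i \in s j then c j i else 0.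
  exists s', (fun i => \sum_j c' j i \oc pr j); split; first exact: undup_uniq.
  rewrite -[f]cmpm1 -pr_sum cmp_sumr.
  transitivity (\sum_j \sum_(i <- s') inT i \oc (c' j i \oc pr j)); last first.
    by rewrite exchange_big; apply: eq_bigr => i _; rewrite cmp_sumr.
  apply: eq_bigr => j _; rewrite cmpA; have [us ->] := cP j.
  rewrite cmp_suml [RHS](bigID (mem (s j))) /= [X in _ + X]big1 ?addr0;
    last first.
    by move=> i nsi; rewrite /c' ifN // cmp0m cmpm0.
  rewrite -[RHS]big_filter; apply: etrans (_ : \sum_(i <- s j)
    inT i \oc (c' j i \oc pr j) = _).
    by rewrite big_seq [RHS]big_seq; apply: eq_bigr => i si;
      rewrite /c' si cmpA.
  apply: perm_big; apply: uniq_perm => //; first exact/filter_uniq/undup_uniq.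
  move=> i; rewrite mem_filter mem_undup; case: (boolP (i \in s j)) => //= si.
  by symmetry; apply/flatten_mapP; exists j; rewrite ?mem_enum.
apply: (dsum_ext dS) => j; rewrite cmp0m.
have [_ uT] := cX j I Y T inT dT.
apply: (uT s (fun i => c i \oc inj j)) => //.
rewrite -[RHS](cmp0m _ (inj j)) -c0 cmp_suml.
by apply: eq_bigr => i' _; rewrite cmpA.
Qed.

End DirectSums.

(** * Equivariant objects *)

(* The action functors and the structure maps of [eqvObj], as constants: the
   terms elaborated from the records carry several convertible but
   syntactically distinct forms of the carrier of [gT]. *)
Definition ga (k : fieldType) (gT : finGroupType) (D : triangCat k)
    (A : gAction gT D) (g : gT) : linFunctor D D := A g.

Definition gaeps (k : fieldType) (gT : finGroupType) (D : triangCat k)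
    (A : gAction gT D) (g h : gT) (X : D) :
  iso (ga A g (ga A h X)) (ga A (g * h)%g X) := aeps A g h X.

Definition theta (k : fieldType) (gT : finGroupType) (D : triangCat k)
    (A : gAction gT D) (g : gT) (n : int) (X : D) :
  iso (ga A g (tsh D n X)) (tsh D n (ga A g X)) := atheta A g n X.

Definition lam (k : fieldType) (gT : finGroupType) (D : triangCat k)
    (A : gAction gT D) (H : {group gT}) (X : eqvCat A H) (g : gT)
    (gH : g \in H) : iso (eobj X) (ga A g (eobj X)) := elin X gH.

Definition und (k : fieldType) (gT : finGroupType) (D : triangCat k)
    (A : gAction gT D) (H : {group gT}) (X Y : eqvCat A H) (f : hom X Y) :
  hom (eobj X) (eobj Y) := submv f.

Section Action.

Context (k : fieldType) (gT : finGroupType) (D : triangCat k).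
Context (A : gAction gT D).

Lemma ga_equiv g : equivalence (ga A g).
Proof. exact: gact_equiv. Qed.

Lemma ga_ff g : fully_faithful (ga A g).
Proof. exact: (proj1 (gact_equiv A g)). Qed.

Lemma ga_faithful g (X Y : D) : injective (@fmap _ _ _ (ga A g) X Y).
Proof. exact/faithful_of_ff/ga_ff. Qed.

Lemma tsh_ff n : fully_faithful (tsh D n).
Proof. exact: (proj1 (@tsh_equiv _ D n)). Qed.

Lemma tsh_faithful n (X Y : D) : injective (@fmap _ _ _ (tsh D n) X Y).
Proof. exact/faithful_of_ff/tsh_ff. Qed.

Lemma gaeps_nat g h (X Y : D) (f : hom X Y) :
  gaeps A g h Y \oc fmap (ga A g) (fmap (ga A h) f)
    = fmap (ga A (g * h)%g) f \oc gaeps A g h X.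
Proof. exact: aeps_nat. Qed.

Lemma gaeps_assoc g h x (X : D) (e : (g * (h * x) = g * h * x)%g) :
  ecast y (hom (ga A g (ga A h (ga A x X))) (ga A y X)) e
    (gaeps A g (h * x)%g X \oc fmap (ga A g) (gaeps A h x X))
    = gaeps A (g * h)%g x X \oc gaeps A g h (ga A x X).
Proof. by rewrite (eq_irrelevance e (mulgA g h x)); exact: aeps_assoc. Qed.

Lemma theta_nat g n (X Y : D) (f : hom X Y) :
  theta A g n Y \oc fmap (ga A g) (fmap (tsh D n) f)
    = fmap (tsh D n) (fmap (ga A g) f) \oc theta A g n X.
Proof. exact: atheta_nat. Qed.

Section Hom.

Context (H : {group gT}).
Implicit Types X Y Z : eqvCat A H.

Lemma lam_irr X g (p q : g \in H) : lam X p = lam X q.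
Proof. by rewrite (bool_irrelevance p q). Qed.

Lemma lam_cocycle X g h (gH : g \in H) (hH : h \in H)
    (ghH : (g * h)%g \in H) :
  gaeps A g h (eobj X) \oc fmap (ga A g) (lam X hH) \oc lam X gH = lam X ghH.
Proof. exact: elin_cocycle. Qed.

Lemma und_inj X Y : injective (@und k gT D A H X Y).
Proof. by move=> f g /val_inj. Qed.

Lemma und0 X Y : und (0 : hom X Y) = 0.
Proof. by []. Qed.

Lemma und_cmp X Y Z (g : hom Y Z) (f : hom X Y) :
  und (g \oc f) = und g \oc und f.
Proof. by []. Qed.

Lemma und1 X : und (idm X) = idm (eobj X).
Proof. by []. Qed.

Lemma und_sum X Y I (r : seq I) (P : pred I) (f : I -> hom X Y) :
  und (\sum_(i <- r | P i) f i) = \sum_(i <- r | P i) und (f i).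
Proof. exact: (big_morph (@und k gT D A H X Y)). Qed.

Lemma und_mk X Y (f : hom (eobj X) (eobj Y)) :
  (forall g (gH : g \in H), fmap (ga A g) f \oc lam X gH = lam Y gH \oc f) ->
  exists f' : hom X Y, und f' = f.
Proof.
move=> fP; have P : f \in @invariant _ _ _ A H X Y by exact/invariantP.
by exists (@Subm _ _ (shom (s := eqvData A H) X Y) f P).
Qed.

Lemma und_eqv X Y (f : hom X Y) g (gH : g \in H) :
  fmap (ga A g) (und f) \oc lam X gH = lam Y gH \oc und f.
Proof. by have /invariantP := submP f; apply. Qed.

(** The conjugation action of H on Hom(X, Y), i.e. [conj_hom] in terms of the constants above; its
    invariants are the morphisms of D^H. *)
Definition cj X Y g (gH : g \in H) (f : hom (eobj X) (eobj Y)) :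
  hom (eobj X) (eobj Y) := bwd (lam Y gH) \oc fmap (ga A g) f \oc lam X gH.

Lemma cjE X Y g (gH : g \in H) (f f' : hom (eobj X) (eobj Y)) :
  cj gH f = f' <-> fmap (ga A g) f \oc lam X gH = lam Y gH \oc f'.
Proof.
rewrite /cj -cmpA; split=> [<- | ->]; first by rewrite cmp_fwdK.
by rewrite cmp_bwdK.
Qed.

Lemma cj_inj X Y g (gH : g \in H) : injective (@cj X Y g gH).
Proof.
move=> f f' /= /cjE; rewrite /cj -cmpA cmp_fwdK => ff'.
by apply: (@ga_faithful g); apply: (iso_epic (e := lam X gH)).
Qed.

Lemma cjM X Y g h (gH : g \in H) (hH : h \in H) (ghH : (g * h)%g \in H)
    (f : hom (eobj X) (eobj Y)) :
  cj gH (cj hH f) = cj ghH f.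
Proof.
apply/cjE; rewrite [cj ghH f]/cj.
apply: (iso_monic (e := fmap_iso (ga A g) (lam Y hH))) => /=.
apply: (iso_monic (e := gaeps A g h (eobj Y))).
rewrite !cmpA (lam_cocycle Y gH hH ghH) fwd_bwd cmp1m.
rewrite -(lam_cocycle X gH hH ghH) !cmpA -gaeps_nat; congr (_ \oc _).
rewrite -!(cmpA (fwd (gaeps A g h _))); congr (_ \oc _).
by rewrite -!fmapM /cj !cmpA fwd_bwd cmp1m.
Qed.

(** Actions carry no unit isomorphism, so this comes from idempotence of conjugation by 1 together
    with its injectivity. *)
Lemma cj1 X Y (H1 : 1%g \in H) (f : hom (eobj X) (eobj Y)) : cj H1 f = f.
Proof.
apply: (cj_inj (gH := H1)) => /=.
have H11 : (1 * 1)%g \in H by rewrite mulg1.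
rewrite (cjM _ _ H11); move: H11; rewrite mulg1 => H11.
by rewrite (bool_irrelevance H11 H1).
Qed.

Lemma eqv_is_dsum (I : Type) (X : I -> eqvCat A H) (S : eqvCat A H)
    (inj : forall i, hom (X i) S) :
  is_direct_sum (fun i => und (inj i)) -> is_direct_sum inj.
Proof.
move=> dS Y f; have [u [uf uu]] := dS _ (fun i => und (f i)).
have [u' u'E] : exists u' : hom S Y, und u' = u.
  apply: und_mk => g gH; apply: (dsum_ext dS) => i.
  by rewrite -!cmpA uf -und_eqv cmpA -fmapM uf und_eqv.
exists u'; split=> [i | v vf]; first by apply: und_inj; rewrite und_cmp u'E uf.
apply: und_inj; rewrite u'E; apply: uu => i.
by rewrite -(vf i) und_cmp.
Qed.

(** Each g_* preserves the sum, being an equivalence, so the linearisations of the summands assemble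
    to one on [S]; the cocycle identity is checked on components. *)
Lemma eqv_lift_dsum (I : Type) (X : I -> eqvCat A H) (S : D)
    (inj : forall i, hom (eobj (X i)) S) :
  is_direct_sum inj ->
  exists (S' : eqvCat A H) (inj' : forall i, hom (X i) S'),
    is_direct_sum (fun i => und (inj' i)).
Proof.
move=> dS.
have dgS g := equivalence_dsum (ga_equiv g) dS.
have [l lE] : exists l : forall x : subg_of H, iso S (ga A (val x) S),
    forall x i, l x \oc inj i
      = fmap (ga A (val x)) (inj i) \oc lam (X i) (subgP x).
  apply: (fin_all_exists (P := fun x (e : iso S (ga A (val x) S)) =>
    forall i, e \oc inj i
      = fmap (ga A (val x)) (inj i) \oc lam (X i) (subgP x))) => x.
  exact: dsum_iso.
pose lin g (gH : g \in H) : iso S (ga A g S) := l (Subg gH).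
have linE g (gH : g \in H) i :
    lin g gH \oc inj i = fmap (ga A g) (inj i) \oc lam (X i) gH.
  by rewrite -(lam_irr (X i) (subgP (Subg gH)) gH); exact: (lE (Subg gH) i).
have coc g h (gH : g \in H) (hH : h \in H) (ghH : (g * h)%g \in H) :
    gaeps A g h S \oc fmap (ga A g) (lin h hH) \oc lin g gH = lin _ ghH.
  apply: (dsum_ext dS) => i; rewrite -!cmpA !linE !cmpA.
  rewrite -(cmpA (fwd (gaeps A g h S))) -fmapM linE fmapM cmpA gaeps_nat.
  by rewrite -(lam_cocycle (X i) gH hH ghH) !cmpA.
pose S' : eqvCat A H := EqvObj coc.
have [inj' inj'E] : exists inj' : forall i, hom (X i) S',
    forall i, und (inj' i) = inj i.
  have P i : inj i \in @invariant _ _ _ A H (X i) S'.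
    by apply/invariantP => g gH; symmetry; exact: linE.
  by exists (fun i => @Subm _ _ (shom (s := eqvData A H) (X i) S') _ (P i)).
exists S', inj' => Y f; have [u [uf uu]] := dS _ f.
exists u; split=> [i | v vf]; first by rewrite inj'E.
by apply: uu => i; rewrite -inj'E.
Qed.

(** The given sum is isomorphic to the lift of a sum of the underlying objects. This allows
    compactness in D^G to be deduced from compactness in D. *)
Lemma eqv_dsum_und : cocomplete D -> forall (I : choiceType)
    (X : I -> eqvCat A H) (S : eqvCat A H) (inj : forall i, hom (X i) S),
  is_direct_sum inj -> is_direct_sum (fun i => und (inj i)).
Proof.
move=> cD I X S inj dS; have [S0 [inj0 dS0]] := cD I (fun i => eobj (X i)).
have [S' [inj' dS']] := eqv_lift_dsum dS0.
have [e eE] := dsum_iso (eqv_is_dsum dS') dS (fun i =>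
  Iso (cmp1m (idm (X i))) (cmp1m (idm (X i)))).
have be : und (bwd e) \oc und e = idm (eobj S').
  by rewrite -und_cmp bwd_fwd.
have eb : und e \oc und (bwd e) = idm (eobj S).
  by rewrite -und_cmp fwd_bwd.
apply: (is_direct_sum_iso dS' (e := Iso be eb) (a := fun i =>
  Iso (cmp1m (idm (eobj (X i)))) (cmp1m (idm (eobj (X i)))))) => i /=.
by rewrite -und_cmp eE und_cmp.
Qed.

End Hom.

End Action.
(** * Induction *)

Section Induction.

Context (k : fieldType) (gT : finGroupType) (D : triangCat k).
Context (A : gAction gT D).

Definition equivariant (H : {group gT}) (X : eqvCat A H)
    (Y : eqvCat A [set: gT]%G) (f : hom (eobj X) (eobj Y)) : Prop :=
  forall g (gH : g \in H),
    fmap (ga A g) f \oc lam X gH = lam Y (in_setT g) \oc f.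

(** The adjunction of Ind and Res with all morphisms taken in D; bijectivity is split into
    uniqueness and existence of the factorisation. *)
Definition induction_arrow (H : {group gT}) (X : eqvCat A H)
    (F : eqvCat A [set: gT]%G) (u : hom (eobj X) (eobj F)) : Prop :=
  [/\ equivariant u,
      forall (Y : eqvCat A [set: gT]%G) (f f' : hom F Y),
        und f \oc u = und f' \oc u -> f = f'
    & forall (Y : eqvCat A [set: gT]%G) (f : hom (eobj X) (eobj Y)),
        equivariant f -> exists f' : hom F Y, und f' \oc u = f].

Lemma is_inducedP (H : {group gT}) (X : eqvCat A H)
    (F : eqvCat A [set: gT]%G) :
  is_induced X F -> exists u, induction_arrow (F := F) (X := X) u.
Proof.
have resE (Y : eqvCat A [set: gT]%G) g (gH : g \in H) :
    lam (Res A (subsetT H) Y) gH = lam Y (in_setT g).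
  by rewrite /lam /= (bool_irrelevance (subsetP (subsetT H) g gH) (in_setT g)).
move=> [u uP]; exists (und u); split=> [g gH | Y f f' ff' | Y f fe].
- rewrite -(resE F g gH).
  exact: (@und_eqv _ _ _ _ H X (Res A (subsetT H) F) u g gH).
- by apply: (bij_inj (uP Y)); apply: und_inj.
have [f0 f0E] : exists f0 : hom X (Res A (subsetT H) Y), und f0 = f.
  by apply: und_mk => g gH; rewrite (resE Y g gH); exact: fe.
have [h _ hK] := uP Y; exists (h f0).
by rewrite -[RHS]f0E -[in RHS](hK f0).
Qed.

Lemma equivariant_und (H : {group gT}) (X : eqvCat A H)
    (F Y : eqvCat A [set: gT]%G) (u : hom (eobj X) (eobj F)) (f : hom F Y) :
  equivariant u -> equivariant (Y := Y) (und f \oc u).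
Proof.
move=> ue g gH; rewrite fmapM -cmpA ue !cmpA.
by rewrite (und_eqv f (in_setT g)).
Qed.

(** [P] is the object induced from the trivial group; its linearisation at h matches the summand (h
    g)_* X with h_* g_* X. *)
Lemma free_equivariant : cocomplete D -> forall X : D,
  exists (P : eqvCat A [set: gT]%G)
    (inj : forall g, hom (ga A g X) (eobj P)),
  is_direct_sum inj /\
  forall h g, lam P (in_setT h) \oc inj (h * g)%g \oc gaeps A h g X
    = fmap (ga A h) (inj g).
Proof.
move=> cD X; have [S [inj dS]] := cD gT (fun g => ga A g X).
have [l lE] : exists l : forall h, iso S (ga A h S),
    forall h g, l h \oc inj (h * g)%g \oc gaeps A h g X = fmap (ga A h) (inj g).
  apply: (fin_all_exists (P := fun h (e : iso S (ga A h S)) => forall g,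
    e \oc inj (h * g)%g \oc gaeps A h g X = fmap (ga A h) (inj g))) => h.
  have bij : bijective (mulg h).
    by exists (mulg h^-1) => x; rewrite ?mulKg ?mulKVg.
  have [e eE] := dsum_iso (dsum_reindex bij dS)
    (equivalence_dsum (ga_equiv A h) dS) (fun g => inv_iso (gaeps A h g X)).
  by exists e => g; rewrite eE -cmpA bwd_fwd cmpm1.
have coc g h (gG : g \in [set: gT]) (hG : h \in [set: gT])
    (ghG : (g * h)%g \in [set: gT]) :
    gaeps A g h S \oc fmap (ga A g) (l h) \oc l g = l (g * h)%g.
  (* Indices are written as g (h x) so that [lE] applies for g and then for h; the cast passes from
     g (h x) to (g h) x. *)
  have key x : gaeps A g h S \oc fmap (ga A g) (l h) \oc l g
        \oc inj (g * (h * x))%g = l (g * h)%g \oc inj (g * (h * x))%g.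
    apply: (iso_epic (e := cmp_iso (gaeps A g (h * x)%g X)
      (fmap_iso (ga A g) (gaeps A h x X)))) => /=.
    have castE y (e : (g * (h * x) = y)%g) (Z : D)
        (f : hom Z (ga A (g * (h * x))%g X)) :
      inj _ \oc f = inj y \oc ecast y (hom Z (ga A y X)) e f.
      by case: y / e.
    rewrite -[in RHS]cmpA (castE _ (mulgA g h x)) gaeps_assoc.
    rewrite [in RHS]cmpA [in RHS]cmpA lE -gaeps_nat -(lE h x) !fmapM.
    by rewrite -(lE g (h * x)%g) !cmpA.
  apply: (dsum_ext dS) => i.
  by have := key (h^-1 * (g^-1 * i))%g; rewrite !mulKVg.
pose P : eqvCat A [set: gT]%G := EqvObj (elin := fun g _ => l g) coc.
by exists P, inj.
Qed.

Section Split.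

Context (H : {group gT}) (X : eqvCat A H) (F : eqvCat A [set: gT]%G).
Context (u : hom (eobj X) (eobj F)).
Hypothesis cD : cocomplete D.
Hypothesis cardH : #|H|%:R != 0 :> k.
Hypothesis uP : induction_arrow u.

(* [F] is a direct summand of the sum [P] of all the [g_* X]: the map F -> P
   adjoint to the sum over [h \in H] of the components [lam X h : X -> h_* X],
   followed by P -> F, is multiplication by #|H|. *)
Lemma induced_split :
  exists (w : hom (eobj F) (eobj X))
    (s : forall g, hom (eobj F) (ga A g (eobj X))),
  w \oc u = idm (eobj X) /\
  \sum_g bwd (lam F (in_setT g)) \oc fmap (ga A g) u \oc s g = idm (eobj F).
Proof.
have [ue uinj usurj] := uP.
have [P [inj [dP lP]]] := free_equivariant cD (eobj X).
have [pr [prK pr0 pr_sum]] := dsum_proj dP.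
(* [lam X] requires a proof of membership in H, hence the extension by zero. *)
pose L g : hom (eobj X) (ga A g (eobj X)) :=
  if (g \in H) =P true is ReflectT gH then fwd (lam X gH) else 0.
have LE g (gH : g \in H) : L g = lam X gH.
  by rewrite /L; case: eqP => // gH'; rewrite (lam_irr X gH' gH).
have L0 g : g \notin H -> L g = 0.
  by move=> /negP nH; rewrite /L; case: eqP => // /nH.
(* Equivariance of the sum follows by reindexing along h |-> g h and the cocycle identity of [X]. *)
have [j jE] : exists j : hom F P, und j \oc u = \sum_g inj g \oc L g.
  apply: usurj => g gH; rewrite fmap_sum cmp_suml cmp_sumr.
  rewrite [RHS](reindex_inj (mulgI g)); apply: eq_bigr => h _ /=.
  rewrite fmapM -lP !cmpA -!cmpA; congr (_ \oc (_ \oc _)).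
  have [hH | nhH] := boolP (h \in H); last first.
    by rewrite !L0 ?groupMl // ?fmap0 ?cmp0m ?cmpm0.
  have ghH : (g * h)%g \in H by rewrite groupM.
  by rewrite !LE cmpA; exact: lam_cocycle.
(* The adjoint of [u]: on g_* X, apply g_* u and return to [F] by the inverse linearisation. *)
have [p0 p0E] := dsum_desc dP (fun g =>
  bwd (lam F (in_setT g)) \oc fmap (ga A g) u).
have [p pE] : exists p : hom P F, und p = p0.
  apply: und_mk => h hG; rewrite (lam_irr P hG (in_setT h)).
  rewrite (lam_irr F hG (in_setT h)).
  have bij : bijective (mulg h).
    by exists (mulg h^-1) => x; rewrite ?mulKg ?mulKVg.
  apply: (dsum_ext (dsum_reindex bij dP)) => g.
  apply: (iso_epic (e := gaeps A h g (eobj X))).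
  rewrite -!(cmpA (fmap _ p0)) lP -fmapM p0E -(cmpA (fwd (lam F _))) p0E.
  rewrite -!cmpA -gaeps_nat.
  apply: (iso_monic (e := fmap_iso (ga A h) (lam F (in_setT g)))) => /=.
  rewrite fmapM cmpA -fmapM fwd_bwd fmap1 cmp1m.
  apply: (iso_monic (e := gaeps A h g (eobj F))).
  have ghG : (h * g)%g \in [set: gT] by exact: in_setT.
  rewrite !cmpA (lam_cocycle F (in_setT h) (in_setT g) ghG).
  by rewrite (lam_irr F ghG (in_setT _)) fwd_bwd cmp1m.
(* It suffices to compose with [u]: each g in H contributes [u] by equivariance, and the other g
   contribute zero. *)
have pj : p \oc j = #|H|%:R *: idm F.
  apply: uinj; rewrite und_cmp -cmpA jE pE cmp_sumr.
  transitivity (\sum_(g in H) u); last first.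
    rewrite sumr_const (_ : und _ = #|H|%:R *: idm (eobj F)) //.
    by rewrite cmpZm cmp1m scaler_nat.
  rewrite (bigID (mem H)) /= [X in _ + X]big1 ?addr0 => [|g gH]; last first.
    by rewrite L0 // !cmpm0.
  apply: eq_bigr => g gH; rewrite LE cmpA p0E -cmpA (ue g gH).
  by rewrite cmp_bwdK.
(* At any [o] in H the component of [und j \oc u] is the isomorphism [lam X oH], whose inverse gives
   a retraction of [u]; dividing by #|H| turns [pj] into the required decomposition of the
   identity. *)
have [o oH] : exists o, o \in H by exists 1%g.
exists (bwd (lam X oH) \oc (pr o \oc und j)),
  (fun g => #|H|%:R^-1 *: (pr g \oc und j)); split.
  rewrite -!cmpA jE cmp_sumr (bigD1 o) //=.
  rewrite big1 => [|g g1]; last by rewrite cmpA pr0 ?cmp0m // eq_sym.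
  by rewrite addr0 (cmpA (pr o)) prK cmp1m LE bwd_fwd.
transitivity (#|H|%:R^-1 *: und (p \oc j)).
  rewrite und_cmp -[und p]cmpm1 -pr_sum pE cmp_sumr cmp_suml scaler_sumr.
  by apply: eq_bigr => g _; rewrite cmpmZ -p0E !cmpA.
rewrite pj (_ : und _ = #|H|%:R *: idm (eobj F)) //.
by rewrite scalerA mulVf // scale1r.
Qed.

End Split.

End Induction.

(** * Induction of a representation tensored with an equivariant object *)

Section RepInduced.

Context (k : fieldType) (gT : finGroupType) (D : triangCat k).
Context (A : gAction gT D).

Section Def.

Context (H : {group gT}) (n : nat) (rho : mx_representation k H n).
Context (E : eqvCat A H).

(* The H-equivariant maps from rho to Hom(E, Y), given on the canonical
   basis. *)
Definition rep_family (Y : eqvCat A [set: gT]%G)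
    (f : 'I_n -> hom (eobj E) (eobj Y)) : Prop :=
  forall g (gH : g \in H) i, lam Y (in_setT g) \oc f i
    = \sum_j rho g i j *: (fmap (ga A g) (f j) \oc lam E gH).

(* [F] is Ind (rho (x) E), with [v] the universal equivariant map from rho to
   Hom(E, F). *)
Record rep_induced (F : eqvCat A [set: gT]%G)
    (v : 'I_n -> hom (eobj E) (eobj F)) : Prop := RepInduced {
  ri_family : rep_family v;
  ri_inj : forall (Y : eqvCat A [set: gT]%G) (f f' : hom F Y),
    (forall i, und f \oc v i = und f' \oc v i) -> f = f';
  ri_surj : forall (Y : eqvCat A [set: gT]%G)
      (f : 'I_n -> hom (eobj E) (eobj Y)),
    rep_family f -> exists f' : hom F Y, forall i, und f' \oc v i = f i;
  ri_left : exists w : 'I_n -> hom (eobj F) (eobj E),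
    forall i j, w j \oc v i = (i == j)%:R *: idm (eobj E);
  ri_split : exists q : forall g, 'I_n -> hom (eobj F) (ga A g (eobj E)),
    \sum_g \sum_j bwd (lam F (in_setT g)) \oc fmap (ga A g) (v j) \oc q g j
      = idm (eobj F);
  ri_span : (forall g, g \notin H ->
      forall f : hom (eobj E) (ga A g (eobj E)), f = 0) ->
    forall f : hom (eobj E) (eobj F),
      exists c : 'I_n -> hom (eobj E) (eobj E), f = \sum_i v i \oc c i;
  ri_compact : compact (eobj E) -> compact F
}.

End Def.

(** Hom(F, -) is the equivariant part of Hom(X, -); the finitely many components of an equivariant
    map into a sum are again equivariant, because components are unique. *)
Lemma induced_compact (H : {group gT}) (X : eqvCat A H)
    (F : eqvCat A [set: gT]%G) (u : hom (eobj X) (eobj F)) :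
  cocomplete D -> induction_arrow u -> compact (eobj X) -> compact F.
Proof.
move=> cD [ue uinj usurj] cX I Y S inj dS.
have [P1 P2] := cX I (fun i => eobj (Y i)) (eobj S) _ (eqv_dsum_und cD dS).
split=> [f | s c us c0 i si]; last first.
  apply: uinj; rewrite und0 cmp0m.
  apply: (P2 s (fun i => und (c i) \oc u)) => //.
  rewrite -[RHS](cmp0m _ u) -[X in X \oc u](und0 F S) -c0 und_sum cmp_suml.
  by apply: eq_bigr => i' _; rewrite cmpA.
have [s [c [us fE]]] := P1 (und f \oc u).
(* Nothing is known about [c] outside [s]; with the value zero there, every component is
   equivariant. *)
pose c' i := if i \in s then c i else 0.
have c'e i : equivariant (c' i).
  move=> g gH; rewrite /c'; case: (boolP (i \in s)) => [si | _]; last first.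
    by rewrite fmap0 cmp0m cmpm0.
  (* The defect of equivariance of [c i]. These defects sum to that of [und f \oc u], which is zero,
     so each of them vanishes. *)
  pose t i := bwd (lam (Y i) (in_setT g)) \oc fmap (ga A g) (c i) \oc lam X gH
    - c i.
  suff /eqP: t i = 0.
    by rewrite subr_eq0 => /eqP tE; rewrite -[in RHS]tE -cmpA cmp_fwdK.
  apply: (P2 s t) => //.
  transitivity (bwd (lam S (in_setT g)) \oc fmap (ga A g) (und f \oc u)
      \oc lam X gH - und f \oc u); last first.
    apply/eqP; rewrite subr_eq0; apply/eqP.
    by rewrite -cmpA (equivariant_und f ue gH) cmp_bwdK.
  rewrite fE fmap_sum cmp_sumr cmp_suml -sumrB; apply: eq_bigr => i' _.
  rewrite /t -scaleN1r cmpmD cmpmZ scaleN1r; congr (_ - _).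
  apply: (iso_monic (e := lam S (in_setT g))).
  rewrite !cmpA fwd_bwd cmp1m -(und_eqv (inj i') (in_setT g)) fmapM.
  by rewrite -!cmpA; congr (_ \oc _); rewrite cmp_fwdK.
have ex i : exists d : hom F (Y i), und d \oc u == c' i.
  by have [d dE] := usurj _ _ (c'e i); exists d; apply/eqP.
exists s, (fun i => xchoose (ex i)); split=> //; apply: uinj.
rewrite fE und_sum cmp_suml big_seq [RHS]big_seq; apply: eq_bigr => i si.
by rewrite und_cmp -cmpA (eqP (xchooseP (ex i))) /c' si.
Qed.

(** Composition with the inclusions of the copies of [E] turns equivariant maps out of [X] into
    families ([famP]); the remaining properties come from [induced_split] and the projections of
    [X]. *)
Lemma rep_inducedP (H : {group gT}) n (rho : mx_representation k H n)
    (E X : eqvCat A H) (F : eqvCat A [set: gT]%G) :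
  cocomplete D -> #|H|%:R != 0 :> k ->
  is_rep_tensor rho E X -> is_induced X F ->
  exists v, rep_induced rho (E := E) (F := F) v.
Proof.
move=> cD cardH [inj [dX injE]] /is_inducedP[u uP].
have [ue uinj usurj] := uP.
have {}injE g (gH : g \in H) i : lam X gH \oc inj i
    = \sum_j rho g i j *: (fmap (ga A g) (inj j) \oc lam E gH).
  exact: injE.
have [pr [prK pr0 pr_sum]] := dsum_proj dX.
have [w [s [wu s_sum]]] := induced_split cD cardH uP.
have famP (Y : eqvCat A [set: gT]%G) (f : hom (eobj X) (eobj Y)) :
    equivariant f <-> rep_family rho (fun i => f \oc inj i).
  split=> [fe g gH i | ff g gH].
    rewrite cmpA -fe -cmpA injE cmp_sumr; apply: eq_bigr => j _.
    by rewrite cmpmZ fmapM cmpA.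
  apply: (dsum_ext dX) => i; rewrite -!cmpA ff injE cmp_sumr.
  by apply: eq_bigr => j _; rewrite cmpmZ fmapM cmpA.
exists (fun i => u \oc inj i); split.
- exact/famP.
- move=> Y f f' ff'; apply: uinj; apply: (dsum_ext dX) => i.
  by rewrite -!cmpA.
- move=> Y f ff; have [f0 f0E] := dsum_desc dX f.
  have [|f' f'E] := usurj Y f0.
    by apply/famP => g gH i; rewrite f0E ff; under [RHS]eq_bigr do rewrite f0E.
  by exists f' => i; rewrite cmpA f'E.
- exists (fun j => pr j \oc w) => i j.
  rewrite -cmpA (cmpA w) wu cmp1m; have [-> | ij] := eqVneq i j.
    by rewrite prK scale1r.
  by rewrite pr0 1?eq_sym // scale0r.
- exists (fun g j => fmap (ga A g) (pr j) \oc s g).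
  rewrite -s_sum; apply: eq_bigr => g _.
  rewrite -[in RHS](cmpm1 u) -pr_sum cmp_sumr fmap_sum cmp_sumr cmp_suml.
  by apply: eq_bigr => j _; rewrite !fmapM !cmpA.
- move=> van f.
  suff [f' ->] : exists f', f = u \oc f'.
    exists (fun i => pr i \oc f'); rewrite -{1}(cmp1m f') -pr_sum cmp_suml.
    by rewrite cmp_sumr; apply: eq_bigr => i _; rewrite !cmpA.
  (* g_* X is a sum of copies of g_* E, which receives no nonzero map from [E] when g is outside
     H. *)
  have van' g : g \notin H -> s g \oc f = 0.
    move=> gH; rewrite -[s g](cmp1m) -(fmap1 (ga A g)) -pr_sum fmap_sum.
    rewrite !cmp_suml big1 // => j _.
    by rewrite fmapM -!cmpA (van g gH (_ \oc (_ \oc f))) cmpm0.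
  (* For g in H, equivariance of [u] rewrites the summand as a map followed by [u]. *)
  have [t tE] : exists t : gT -> hom (eobj E) (eobj X), forall g,
      bwd (lam F (in_setT g)) \oc fmap (ga A g) u \oc s g \oc f = u \oc t g.
    apply: (fin_all_exists (P := fun g t => bwd (lam F (in_setT g))
      \oc fmap (ga A g) u \oc s g \oc f = u \oc t)) => g.
    have [gH | gH] := boolP (g \in H).
      exists (bwd (lam X gH) \oc (s g \oc f)); rewrite -!cmpA.
      apply: (iso_monic (e := lam F (in_setT g))).
      by rewrite cmp_fwdK [RHS]cmpA -ue -[RHS]cmpA cmp_fwdK.
    by exists 0; rewrite -cmpA van' // !cmpm0.
  exists (\sum_g t g).
  rewrite -{1}[f]cmp1m -s_sum cmp_suml cmp_sumr; apply: eq_bigr => g _.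
  exact: tE.
- move=> cE; apply: (induced_compact cD uP).
  exact: (compact_dsum dX (fun=> cE)).
Qed.

End RepInduced.
(** * Representations and morphisms of induced objects *)

Section Linear.

Context (k : fieldType) (V : lmodType k).

Lemma lincombM m n p (M : 'M[k]_(m, n)) (N : 'M[k]_(n, p)) (w : 'I_p -> V) i :
  \sum_j M i j *: (\sum_l N j l *: w l) = \sum_l (M *m N) i l *: w l.
Proof.
under eq_bigr do rewrite scaler_sumr.
rewrite exchange_big; apply: eq_bigr => l _; rewrite mxE scaler_suml.
by apply: eq_bigr => j _; rewrite scalerA.
Qed.

Lemma lincomb1 n (w : 'I_n -> V) i : \sum_j (1%:M : 'M[k]_n) i j *: w j = w i.
Proof.
rewrite (bigD1 i) //= mxE eqxx scale1r big1 ?addr0 // => j ji.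
by rewrite mxE eq_sym (negPf ji) scale0r.
Qed.

End Linear.

(** Schur's lemma: the row space of [M] is a nonzero submodule of [rho'], and its kernel a proper
    submodule of [rho]. *)
Lemma irr_intertwiner (k : fieldType) (gT : finGroupType) (H : {group gT})
    n n' (rho : mx_representation k H n) (rho' : mx_representation k H n')
    (M : 'M_(n, n')) :
  mx_irreducible rho -> mx_irreducible rho' -> M != 0 ->
  (forall g, g \in H -> rho g *m M = M *m rho' g) ->
  row_free M && row_full M.
Proof.
move=> [_ _ irr] [_ _ irr'] M0 hM.
have full : row_full M.
  (* Irreducibility quantifies over square matrices, so the row space is represented by [genmx]. *)
  rewrite -sub1mx -(genmxE M); apply: irr'; rewrite ?submx1 //.
    apply/mxmoduleP => g gH; rewrite (eqmxMr _ (genmxE M)) genmxE -hM //.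
    exact: submxMl.
  by rewrite -mxrank_eq0 genmxE mxrank_eq0.
rewrite full andbT -kermx_eq0; apply: contraTT isT => ker0.
have /submxP[B kerE] : (1%:M <= kermx M)%MS.
  apply: irr; rewrite ?submx1 //; apply/mxmoduleP => g gH.
  by apply/sub_kermxP; rewrite -mulmxA hM // mulmxA mulmx_ker mul0mx.
by case/eqP: M0; rewrite -[M]mul1mx kerE -mulmxA mulmx_ker mulmx0.
Qed.

Section RepFamily.

Context (k : fieldType) (gT : finGroupType) (D : triangCat k).
Context (A : gAction gT D) (H : {group gT}) (E : eqvCat A H).

Lemma rep_family_mx n n' (rho : mx_representation k H n)
    (rho' : mx_representation k H n') (M : 'M_(n, n'))
    (Y : eqvCat A [set: gT]%G) (f : 'I_n' -> hom (eobj E) (eobj Y)) :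
  (forall g, g \in H -> rho g *m M = M *m rho' g) -> rep_family rho' f ->
  rep_family rho (fun i => \sum_j M i j *: f j).
Proof.
move=> hM hf g gH i; rewrite cmp_sumr.
transitivity (\sum_l (M *m rho' g) i l *: (fmap (ga A g) (f l) \oc lam E gH)).
  by rewrite -lincombM; apply: eq_bigr => j _; rewrite cmpmZ hf.
rewrite -hM // -lincombM; apply: eq_bigr => j _; congr (_ *: _).
rewrite fmap_sum cmp_suml; apply: eq_bigr => l _.
by rewrite fmapZ cmpZm.
Qed.

Lemma rep_family_und n (rho : mx_representation k H n)
    (Y Z : eqvCat A [set: gT]%G) (f : hom Y Z)
    (v : 'I_n -> hom (eobj E) (eobj Y)) :
  rep_family rho v -> rep_family rho (fun i => und f \oc v i).
Proof.
move=> hv g gH i.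
rewrite cmpA -(und_eqv f (in_setT g)) -cmpA hv cmp_sumr.
by apply: eq_bigr => j _; rewrite cmpmZ fmapM cmpA.
Qed.

(* A vector of Hom(E, Y) generates a quotient of the regular representation. *)
Lemma rep_family_regular (Y : eqvCat A [set: gT]%G)
    (phi : hom (eobj E) (eobj Y)) :
  exists f : 'I_#|H| -> hom (eobj E) (eobj Y),
    rep_family (regular_repr k H) f /\ exists i, f i = phi.
Proof.
pose Yr : eqvCat A H := Res A (subsetT H) Y.
have iH (i : 'I_#|H|) : ((enum_val i)^-1)%g \in H.
  by rewrite groupV enum_valP.
(* Conjugation acts on the left and the regular representation on the right, hence the inverse:
   conjugation by g takes the vector at x g to the one at x. *)
exists (fun i => @cj k gT D A H E Yr _ (iH i) phi); split; last first.
  exists (gring_index H 1%g).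
  move: (iH _); rewrite gring_indexK // invg1 => H1.
  exact: (@cj1 k gT D A H E Yr H1 phi).
move=> g gH i.
have -> : lam Y (in_setT g) = lam Yr gH.
  by rewrite /lam /= (bool_irrelevance (subsetP (subsetT H) g gH) (in_setT g)).
rewrite (bigD1 (gring_index H (enum_val i * g))) //= big1 => [|j ji];
  last by rewrite !mxE (negPf ji) scale0r.
rewrite !mxE !eqxx scale1r addr0; symmetry.
apply/(@cjE k gT D A H E Yr).
move: (iH _); rewrite gring_indexK ?groupM ?enum_valP // => iH'.
have iH2 : (g * (enum_val i * g)^-1)%g \in H by rewrite groupM.
rewrite (cjM _ _ iH2); move: iH2 (iH i).
by rewrite invMg mulKVg => iH2 iH3; rewrite (bool_irrelevance iH2 iH3).
Qed.

(** By Maschke's theorem the regular module is a sum of simple submodules, and the family generated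
    by [phi] restricts to zero on each. *)
Lemma irr_families_detect (Y : eqvCat A [set: gT]%G) :
  #|H|%:R != 0 :> k ->
  (forall n (rho : mx_representation k H n), mx_irreducible rho ->
     forall f : 'I_n -> hom (eobj E) (eobj Y), rep_family rho f ->
     forall i, f i = 0) ->
  forall phi : hom (eobj E) (eobj Y), phi = 0.
Proof.
move=> cardH irr0 phi; have [f [hf [i0 <-]]] := rep_family_regular phi.
apply/eqP; have pH : pgroup.pgroup ([pchar k]^') H.
  by rewrite /pgroup.pgroup -natf_neq0_pchar.
apply: (mx_reducible_semisimple (mxmodule1 (regular_repr k H))
  (mx_Maschke_pchar _ pH)) => -[I U /= simU sumU _].
have U0 i b : \sum_j U i b j *: f j = 0.
  have Umod := mxsimple_module (simU i).
  (* The rows of [val_submod 1%:M] form a basis of the submodule on which the irreducible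
     subrepresentation acts; the rows of [U i] are combinations of them. *)
  have /submxP[C UE] : (U i <= val_submod (1%:M : 'M_(\rank (U i))))%MS.
    by rewrite val_submod1.
  rewrite UE -lincombM big1 // => l _.
  rewrite (irr0 _ _ (proj2 (submod_mx_irr Umod) (simU i))
    (fun a => \sum_j val_submod 1%:M a j *: f j)) ?scaler0 //.
  apply: rep_family_mx hf => g gH; rewrite -val_submodJ // mul1mx.
  by rewrite [RHS]val_submodE.
have /sub_sumsmxP[C E1] : ((1%:M : 'M_#|H|) <= \sum_i U i)%MS by rewrite sumU.
rewrite -[f i0]lincomb1 E1; under eq_bigr do rewrite summxE scaler_suml.
rewrite exchange_big big1 // => i _; rewrite -lincombM big1 // => b _.
by rewrite U0 scaler0.
Qed.

End RepFamily.

(** * Shifts, the group action and degree zero *)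

Section Shift.

Context (k : fieldType) (gT : finGroupType) (D : triangCat k).
Context (A : gAction gT D).

Lemma hom_tsh_ga (X Y : D) n g :
  (forall f : hom (ga A g X) (tsh D n (ga A g Y)), f = 0) ->
  forall f : hom X (tsh D n Y), f = 0.
Proof.
move=> z f; apply: (@ga_faithful _ _ _ A g).
apply: (iso_monic (e := theta A g n Y)).
by rewrite fmap0 cmpm0; exact: z.
Qed.

Lemma theta_conj g n (X Y : D) (f : hom X Y) :
  fmap (tsh D n) (fmap (ga A g) f)
    = theta A g n Y \oc fmap (ga A g) (fmap (tsh D n) f)
      \oc bwd (theta A g n X).
Proof. by rewrite theta_nat -cmpA fwd_bwd cmpm1. Qed.

(** A substitute for the isomorphism between X[0] and X, which is not part of the data. *)
Definition sh00 (X : D) : iso (tsh D 0 (tsh D 0 X)) (tsh D 0 X) :=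
  aeps (tsh D) 0 0 X.

Lemma sh00_nat (X Y : D) (f : hom X Y) :
  sh00 Y \oc fmap (tsh D 0) (fmap (tsh D 0) f) = fmap (tsh D 0) f \oc sh00 X.
Proof. exact: (aeps_nat (tsh D) 0 0 f). Qed.

Lemma theta_sh00 g (X : D) :
  theta A g 0 X \oc fmap (ga A g) (sh00 X)
    = sh00 (ga A g X) \oc fmap (tsh D 0) (theta A g 0 X)
      \oc theta A g 0 (tsh D 0 X).
Proof. exact: (atheta_shift A g 0 0 X). Qed.

(** Since [0] is full, the inverse of [sh00 Y] is the shift of some p : Y -> Y[0]; then [p \oc f] is
    zero, and faithfulness of [0] gives [f = 0]. *)
Lemma hom_sh0 (X Y : D) :
  (forall f : hom X (tsh D 0 Y), f = 0) -> forall f : hom X Y, f = 0.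
Proof.
move=> z f; have [p pE] := full_of_ff (@tsh_ff _ D 0) (bwd (sh00 Y)).
apply: (@tsh_faithful _ D 0); apply: (iso_monic (e := inv_iso (sh00 Y))).
by rewrite /= -pE fmap0 cmpm0 -fmapM (z (_ \oc _)) fmap0.
Qed.

(** A morphism X -> Y[0] comes from a morphism [p] : X -> Y through [sh00]; invariance of [p] is
    verified after applying the faithful functor [0]. *)
Lemma eqv_hom_sh0 (H : {group gT}) (X Y : eqvCat A H) :
  (forall f : hom X Y, f = 0) -> forall f : hom X (eqv_sh A H 0 Y), f = 0.
Proof.
move=> z f; pose f0 : hom (eobj X) (tsh D 0 (eobj Y)) := und f.
have f0E g (gH : g \in H) : fmap (ga A g) f0 \oc lam X gH
    = bwd (theta A g 0 (eobj Y)) \oc fmap (tsh D 0) (lam Y gH) \oc f0.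
  exact: (und_eqv f gH).
have [p pE] := full_of_ff (@tsh_ff _ D 0) (sh00 (eobj Y) \oc fmap (tsh D 0) f0).
have [q qE] : exists q : hom X Y, und q = p.
  apply: und_mk => g gH; apply: (@tsh_faithful _ D 0).
  rewrite !fmapM theta_conj pE !fmapM !cmpA theta_sh00.
  rewrite -sh00_nat -!(cmpA (sh00 _ : hom _ _)); congr (_ \oc _).
  transitivity (fmap (tsh D 0) (theta A g 0 (eobj Y))
      \oc fmap (tsh D 0) (fmap (ga A g) f0) \oc fmap (tsh D 0) (lam X gH)).
    by rewrite (theta_conj g 0 f0) !cmpA.
  by rewrite -cmpA -!fmapM f0E !cmpA fwd_bwd cmp1m.
have p0 : p = 0 by rewrite -qE (z q).
apply: und_inj; apply: (@tsh_faithful _ D 0).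
apply: (iso_monic (e := sh00 (eobj Y))); rewrite und0 fmap0 cmpm0.
by rewrite -[LHS]pE p0 fmap0.
Qed.

End Shift.

(** * Morphisms between induced objects *)

Section RepInducedHom.

Context (k : fieldType) (gT : finGroupType) (D : triangCat k).
Context (A : gAction gT D).

(** Such a morphism is determined by maps E -> F'[m], and the identity of F' is a sum of maps
    through the g_* E'. The two subgroups may differ, so this serves within a block and between
    blocks. *)
Lemma rep_induced_hom_sh0 (H H' : {group gT}) n n'
    (rho : mx_representation k H n) (rho' : mx_representation k H' n')
    (E : eqvCat A H) (E' : eqvCat A H') (F F' : eqvCat A [set: gT]%G)
    (v : 'I_n -> hom (eobj E) (eobj F))
    (v' : 'I_n' -> hom (eobj E') (eobj F')) (m : int) :
  rep_induced rho v -> rep_induced rho' v' ->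
  (forall g (f : hom (eobj E) (tsh D m (ga A g (eobj E')))), f = 0) ->
  forall f : hom F (eqv_sh A [set: gT]%G m F'), f = 0.
Proof.
move=> Fv Fv' z f; apply: (ri_inj Fv) => i; rewrite und0 cmp0m.
have [q qE] := ri_split Fv'.
have: fmap (tsh D m) (idm (eobj F')) \oc (und f \oc v i) = 0.
  rewrite -qE fmap_sum cmp_suml big1 // => g _.
  rewrite fmap_sum cmp_suml big1 // => j _.
  by rewrite fmapM -cmpA (z g (_ \oc _)) cmpm0.
by rewrite fmap1 cmp1m.
Qed.

Section SameObject.

Context (H : {group gT}) (E : eqvCat A H).
Hypothesis E0 : idm (eobj E) != 0.
Hypothesis E_scal : forall f : hom (eobj E) (eobj E),
  exists c, f = c *: idm (eobj E).
Hypothesis E_orth : forall g, g \notin H ->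
  forall f : hom (eobj E) (ga A g (eobj E)), f = 0.

Section One.

Context (n : nat) (rho : mx_representation k H n) (F : eqvCat A [set: gT]%G).
Context (v : 'I_n -> hom (eobj E) (eobj F)) (Fv : rep_induced rho v).

(** The left inverses from [ri_left] read off the coefficients. With [rep_induced_coord], [v] is a
    basis of Hom(E, F). *)
Lemma rep_induced_free (c : 'I_n -> k) :
  \sum_j c j *: v j = 0 -> forall j, c j = 0.
Proof.
have [w wE] := ri_left Fv.
move=> c0 j; have: w j \oc (\sum_j c j *: v j) = 0 by rewrite c0 cmpm0.
rewrite cmp_sumr (bigD1 j) //= big1 => [|i ij]; last first.
  by rewrite cmpmZ wE (negPf ij) scale0r scaler0.
rewrite addr0 cmpmZ wE eqxx scale1r => /eqP.
by rewrite scaler_eq0 (negPf E0) orbF => /eqP.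
Qed.

Lemma rep_induced_coord (f : hom (eobj E) (eobj F)) :
  exists c : 'I_n -> k, f = \sum_j c j *: v j.
Proof.
have [c ->] := ri_span Fv E_orth f.
have [d dE] := fin_all_exists (fun i => E_scal (c i)).
by exists d; apply: eq_bigr => i _; rewrite dE cmpmZ cmpm1.
Qed.

End One.

Section Two.

Context (n n' : nat).
Context (rho : mx_representation k H n) (rho' : mx_representation k H n').
Context (F F' : eqvCat A [set: gT]%G).
Context (v : 'I_n -> hom (eobj E) (eobj F)) (Fv : rep_induced rho v).
Context (v' : 'I_n' -> hom (eobj E) (eobj F')) (Fv' : rep_induced rho' v').

(** [M] is the matrix of composition with [f] in the bases [v] and [v']; equivariance of the two
    families makes it an intertwiner. *)
Lemma rep_induced_hom_mx (f : hom F F') :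
  exists M : 'M[k]_(n, n'),
    (forall i, und f \oc v i = \sum_j M i j *: v' j) /\
    (forall g, g \in H -> rho g *m M = M *m rho' g).
Proof.
have [c cE] := fin_all_exists (fun i => rep_induced_coord Fv' (und f \oc v i)).
pose M : 'M_(n, n') := \matrix_(i, j) c i j.
have ME i : und f \oc v i = \sum_j M i j *: v' j.
  by rewrite cE; apply: eq_bigr => j _; rewrite mxE.
exists M; split=> // g gH.
pose W l := fmap (ga A g) (v' l) \oc lam E gH.
apply/matrixP => i.
suff MW : forall l, (rho g *m M) i l - (M *m rho' g) i l = 0.
  by move=> l; apply/eqP; rewrite -subr_eq0 MW.
(* Both families expand in the maps [W l]. Their independence reduces to that of [v'], as g_* is
   faithful and the linearisation invertible. *)
apply: (rep_induced_free Fv'); apply: (@ga_faithful _ _ _ A g).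
apply: (iso_epic (e := lam E gH)); rewrite fmap0 cmp0m fmap_sum cmp_suml.
transitivity (\sum_l (rho g *m M) i l *: W l
  - \sum_l (M *m rho' g) i l *: W l).
  rewrite -sumrB; apply: eq_bigr => l _.
  by rewrite fmapZ cmpZm scalerBl.
apply/eqP; rewrite subr_eq0 -!lincombM; apply/eqP.
have := rep_family_und f (ri_family Fv) gH i; rewrite ME cmp_sumr => famE.
transitivity (lam F' (in_setT g) \oc \sum_j M i j *: v' j).
  rewrite cmp_sumr famE; apply: eq_bigr => j _; rewrite ME fmap_sum cmp_suml.
  by congr (_ *: _); apply: eq_bigr => l _; rewrite fmapZ cmpZm.
by rewrite cmp_sumr; apply: eq_bigr => j _; rewrite cmpmZ (ri_family Fv').
Qed.

Lemma rep_induced_mx_hom (M : 'M[k]_(n, n')) :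
  (forall g, g \in H -> rho g *m M = M *m rho' g) ->
  exists f : hom F F', forall i, und f \oc v i = \sum_j M i j *: v' j.
Proof.
by move=> hM; apply: (ri_surj Fv); exact: rep_family_mx hM (ri_family Fv').
Qed.

Lemma rep_induced_mx0 (f : hom F F') :
  (forall i, und f \oc v i = \sum_j (0 : 'M[k]_(n, n')) i j *: v' j) -> f = 0.
Proof.
move=> f0; apply: (ri_inj Fv) => i; rewrite f0 und0 cmp0m big1 // => j _.
by rewrite mxE scale0r.
Qed.

Lemma rep_induced_hom0 : mx_irreducible rho -> mx_irreducible rho' ->
  ~ mx_rsim rho rho' -> forall f : hom F F', f = 0.
Proof.
move=> irr irr' nsim f; have [M [ME hM]] := rep_induced_hom_mx f.
have [M0 | M0] := eqVneq M 0; first by apply: rep_induced_mx0; rewrite -M0.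
have /andP[freeM fullM] := irr_intertwiner irr irr' M0 hM.
case: nsim; apply: (MxReprSim (B := M)) => //.
by rewrite -(eqP freeM) (eqP fullM).
Qed.

End Two.

Context (n : nat) (rho : mx_representation k H n) (F : eqvCat A [set: gT]%G).
Context (v : 'I_n -> hom (eobj E) (eobj F)) (Fv : rep_induced rho v).

Lemma rep_induced_division : mx_irreducible rho ->
  end_division (F : eqv_shCat A [set: gT]%G).
Proof.
move=> irr; split=> [|f f0].
  (* If [F] were zero, so would be [v]; its independence would then make the identity matrix zero,
     although the degree of [rho] is positive. *)
  apply: contraTneq isT => F0; have [_ n0 _] := irr; case/negP: n0.
  apply/eqP/matrixP => i j; rewrite [RHS]mxE.
  apply: (rep_induced_free Fv (c := fun j => 1%:M i j)).
  rewrite lincomb1 -[LHS]cmp1m -[idm _]/(und (idm F)).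
  by rewrite (F0 : idm F = 0) und0 cmp0m.
have [M [ME hM]] := rep_induced_hom_mx Fv Fv f.
have [M0 | M0] := eqVneq M 0.
  by case/eqP: f0; apply: (rep_induced_mx0 Fv (v' := v)); rewrite -M0.
have /andP[freeM fullM] := irr_intertwiner irr irr M0 hM.
(* By Schur's lemma [M] is invertible; its inverse is again an intertwiner and so defines the
   inverse of [f]. *)
have [N [MN NM]] : exists N, M *m N = 1%:M /\ N *m M = 1%:M.
  by exists (pinvmx M); rewrite mulmxVp // mulVpmx.
have hN g : g \in H -> rho g *m N = N *m rho g.
  move=> gH; rewrite -[LHS]mul1mx -NM -!mulmxA; congr (_ *m _).
  by rewrite mulmxA -(hM _ gH) -mulmxA MN mulmx1.
have [g gE] := rep_induced_mx_hom Fv Fv hN.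
exists g; split; apply: (ri_inj Fv) => i; rewrite und_cmp -cmpA und1 cmp1m.
  rewrite ME cmp_sumr -[RHS]lincomb1 -MN -lincombM; apply: eq_bigr => j _.
  by rewrite cmpmZ gE.
rewrite gE cmp_sumr -[RHS]lincomb1 -NM -lincombM; apply: eq_bigr => j _.
by rewrite cmpmZ ME.
Qed.

(** End F corresponds to the commutant of [rho]; the rows of the centraliser matrix span it and
    yield a finite generating family. *)
Lemma rep_induced_fin_dim : fin_dim (hom F F).
Proof.
pose C := 'C(enveloping_algebra_mx rho)%MS.
have rowC i : forall g, g \in H ->
    rho g *m vec_mx (row i C) = vec_mx (row i C) *m rho g.
  have : (vec_mx (row i C) \in 'C(enveloping_algebra_mx rho))%MS.
    by rewrite vec_mxK row_sub.
  by rewrite memmx_cent_envelop => /centgmxP cM g gH; rewrite cM.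
have [f fE] := fin_all_exists (fun i => rep_induced_mx_hom Fv Fv (rowC i)).
exists _, f => x; have [M [ME hM]] := rep_induced_hom_mx Fv Fv x.
have /submxP[c cE] : (M \in 'C(enveloping_algebra_mx rho))%MS.
  by rewrite memmx_cent_envelop; apply/centgmxP => g gH; rewrite hM.
exists (c 0); apply: (ri_inj Fv) => i; rewrite und_sum cmp_suml ME.
have -> : M = \sum_l c 0 l *: vec_mx (row l C).
  rewrite -[M]mxvecK cE mulmx_sum_row linear_sum.
  by under eq_bigr do rewrite linearZ.
under eq_bigr do rewrite summxE scaler_suml.
rewrite exchange_big; apply: eq_bigr => l _.
rewrite (_ : und (c 0 l *: f l) = c 0 l *: und (f l)) // cmpZm fE scaler_sumr.
by apply: eq_bigr => j _; rewrite mxE scalerA.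
Qed.

End SameObject.

End RepInducedHom.

(** * The induced collection *)

Lemma pchar_coprime_natf_neq0 (k : fieldType) m n :
  (0 < m)%N -> (forall p, p \in [pchar k] -> coprime p m) -> (n %| m)%N ->
  n%:R != 0 :> k.
Proof.
move=> m0 cop nm; rewrite natf_neq0_pchar.
apply/pnatP => [|p p_pr pn]; first exact: dvdn_gt0 nm.
rewrite inE /=; apply/negP => /cop; rewrite prime_coprime //.
by rewrite (dvdn_trans pn nm).
Qed.

Lemma irr_hom_detect (k : fieldType) (gT : finGroupType) (D : triangCat k)
    (A : gAction gT D) (H : {group gT}) (E : eqvCat A H) (r : nat)
    (d : 'I_r -> nat) (rho : forall s, mx_representation k H (d s))
    (F : 'I_r -> eqvCat A [set: gT]%G) (Y : eqvCat A [set: gT]%G) :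
  #|H|%:R != 0 :> k -> enumerates_irr rho ->
  (forall s, exists v, rep_induced (rho s) (E := E) (F := F s) v) ->
  (forall s (f : hom (F s) Y), f = 0) ->
  forall phi : hom (eobj E) (eobj Y), phi = 0.
Proof.
move=> cardH [_ _ irrP] Fv FY0.
apply: irr_families_detect => // n sg irr f hf i.
have [s /mx_rsim_sym[B dn freeB hB]] := irrP n sg irr.
have [v sv] := Fv s.
have [f' f'E] := ri_surj sv (rep_family_mx hB hf).
(* The similarity [B] pulls the family back to one for [rho s], which factors through [F s] and
   hence vanishes; invertibility of [B] recovers [f]. *)
have fullB : row_full B by rewrite /row_full (eqP freeB) dn.
rewrite -[f i]lincomb1 -(mulVpmx fullB) -lincombM big1 // => j _.
by rewrite -f'E (FY0 s f') und0 cmp0m scaler0.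
Qed.

Theorem theorem3p9
  (k : fieldType) (gT : finGroupType)
  (char_k : forall p, p \in [pchar k] -> coprime p #|[set: gT]|)
  (D : triangCat k) (D_cocomplete : cocomplete D)
  (A : gAction gT D)
  (B : dgEnhancement D) (A_lifts : dgLift A B)
  (D_hom_finite : hom_finite (tri_shCat D))
  (m : nat) (l : 'I_m -> nat)
  (E : forall i : 'I_m, 'I_(l i).+1 -> D)
  (E_exc : @exceptional_collection k (tri_shCat D)
             {i : 'I_m & 'I_(l i).+1} (@block_lt m (fun i => (l i).+1))
             (fun x => E (tag x) (tagged x)))
  (E_full : @full k (tri_shCat D) {i : 'I_m & 'I_(l i).+1}
             (fun x => E (tag x) (tagged x)))
  (a : forall i : 'I_m, leftAction gT 'I_(l i).+1)
  (a_trans : forall i, transitive_action (a i))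
  (a_E : forall i g (j : 'I_(l i).+1),
     isomorphic (A g (E i j)) (E i (a i g j)))
  (calE : forall i, eqvCat A (stabiliser (a i) ord0))
  (calE_res : forall i, eobj (calE i) = E i ord0)
  (r : 'I_m -> nat) (d : forall i, 'I_(r i) -> nat)
  (rho : forall i (s : 'I_(r i)),
     mx_representation k (stabiliser (a i) ord0) (d i s))
  (rho_irr : forall i, enumerates_irr (rho i))
  (rhoE : forall i, 'I_(r i) -> eqvCat A (stabiliser (a i) ord0))
  (rhoE_tensor : forall i s, is_rep_tensor (rho i s) (calE i) (rhoE i s))
  (F : forall i, 'I_(r i) -> eqvCat A [set: gT]%G)
  (F_ind : forall i s, is_induced (rhoE i s) (F i s)) :
  [/\ @w_exceptional_collection k (eqv_shCat A [set: gT]%G)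
        {i : 'I_m & 'I_(r i)} (block_lt (l := r))
        (fun x => F (tag x) (tagged x)),
      @full k (eqv_shCat A [set: gT]%G) {i : 'I_m & 'I_(r i)}
        (fun x => F (tag x) (tagged x))
    & @strong k (tri_shCat D) {i : 'I_m & 'I_(l i).+1}
        (fun x => E (tag x) (tagged x)) ->
      @strong k (eqv_shCat A [set: gT]%G) {i : 'I_m & 'I_(r i)}
        (fun x => F (tag x) (tagged x))].
Proof.
have exc i j : exceptional (E i j : tri_shCat D) :=
  proj1 E_exc (existT (fun i => 'I_(l i).+1) i j).
have blk (i j : 'I_m) x y n : (j < i)%N ->
    forall f : hom (E i x) (tsh D n (E j y)), f = 0.
  move=> ji; apply: (proj2 E_exc (existT (fun i => 'I_(l i).+1) j y)
    (existT (fun i => 'I_(l i).+1) i x)).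
  by rewrite /block_lt /= ji.
have orth i x y n : x != y -> forall f : hom (E i x) (tsh D n (E i y)), f = 0.
  (* The collection only gives vanishing from later to earlier members. Translating [y] to the first
     position of the block makes the translate of [x] a later member. *)
  move=> xy; have [g gy] := a_trans i y ord0.
  apply: (@hom_tsh_ga _ _ _ A _ _ _ g).
  have [ex] := a_E i g x; have [ey] := a_E i g y; rewrite gy in ey.
  apply: (hom_zero_iso ex (fmap_iso (tsh D n) ey)).
  apply: (proj2 E_exc (existT (fun i => 'I_(l i).+1) i ord0)
    (existT (fun i => 'I_(l i).+1) i (a i g x))).
  rewrite /block_lt /= eqxx lt0n; apply/orP; right; apply: contraNN xy => gx.
  apply/eqP; rewrite -(lact1 (a i) x) -(lact1 (a i) y) -(mulVg g) !lactM gy.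
  by congr (a i _ _); apply/val_inj/eqP.
have transfer i j g n :
    (forall f : hom (E i ord0) (tsh D n (E j (a j g ord0))), f = 0) ->
    forall f : hom (eobj (calE i)) (tsh D n (ga A g (eobj (calE j)))), f = 0.
  rewrite !calE_res => z; have [e] := a_E j g ord0.
  exact: (hom_zero_iso (Iso (cmp1m (idm _)) (cmp1m (idm _)))
    (fmap_iso (tsh D n) e) z).
pose H i := stabiliser (a i) ord0.
have cardH i : #|H i|%:R != 0 :> k.
  apply: (@pchar_coprime_natf_neq0 k #|[set: gT]|) => //.
  exact: (cardSg (subsetT (H i))).
have Fv i s : exists v, rep_induced (rho i s) (E := calE i) (F := F i s) v.
  exact: (rep_inducedP D_cocomplete (cardH i) (rhoE_tensor i s) (F_ind i s)).
have deg0 i n g : n != 0 ->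
    forall f : hom (eobj (calE i)) (tsh D n (ga A g (eobj (calE i)))), f = 0.
  (* Either g fixes the first index and the object is exceptional, or the two members of the block
     are orthogonal. *)
  move=> n0; apply: transfer; have [-> | gi] := eqVneq (a i g ord0) ord0.
    by have [[_ E0 _ _] _] := exc i ord0; apply: E0.
  by apply: orth; rewrite eq_sym.
have E_id i : idm (eobj (calE i)) != 0.
  by rewrite calE_res; have [[_ _ _ []]] := exc i ord0.
have E_scal i (f : hom (eobj (calE i)) (eobj (calE i))) :
    exists c, f = c *: idm (eobj (calE i)).
  by move: f; rewrite calE_res; have [_] := exc i ord0.
have E_orth i g : g \notin H i ->
    forall f : hom (eobj (calE i)) (ga A g (eobj (calE i))), f = 0.
  move=> gH; apply: hom_sh0; apply: transfer; apply: orth.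
  by rewrite eq_sym; apply: contraNN gH; rewrite inE.
have F_compact i s : compact (F i s).
  have [v sv] := Fv i s; apply: (ri_compact sv); rewrite calE_res.
  by have [[]] := exc i ord0.
have F_van i j s t n :
    (forall g (f : hom (eobj (calE i)) (tsh D n (ga A g (eobj (calE j))))),
      f = 0) ->
    forall f : hom (F i s) (eqv_sh A [set: gT]%G n (F j t)), f = 0.
  have [v sv] := Fv i s; have [v' sv'] := Fv j t.
  exact: rep_induced_hom_sh0 sv sv'.
split.
- split=> [[i s] | [i s] [j t]] /=.
    have [v sv] := Fv i s; have [irr _ _] := rho_irr i; split.
    + exact: F_compact.
    + by move=> n n0; apply: F_van => g; exact: deg0.
    + exact: (rep_induced_fin_dim (E_id i) (E_scal i) (@E_orth i) sv).
    + exact: (rep_induced_division (E_id i) (E_scal i) (@E_orth i) sv).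
  move=> lt n; have [ij | ij] := ltnP i j.
    by apply: F_van => g; apply: transfer; apply: blk.
  move: lt; rewrite /block_lt /= ltnNge ij /= => /andP[/eqP eij].
  (* Within a block, nonzero degrees are settled by [deg0]; degree zero rests on Schur's lemma,
     distinct indices giving non-similar representations. *)
  move: t; rewrite -eij => t /= st; have [-> | n0] := eqVneq n 0; last first.
    by apply: F_van => g; exact: deg0.
  apply: eqv_hom_sh0; have [irr inj_irr _] := rho_irr i.
  have [v sv] := Fv i s; have [v' sv'] := Fv i t.
  apply: (rep_induced_hom0 (E_id i) (E_scal i) (@E_orth i) sv' sv) => //.
  by move=> /inj_irr ts; rewrite ts ltnn in st.
- pose FF (x : {i : 'I_m & 'I_(r i)}) := F (tag x) (tagged x).
  (* The sum of the [F] is formed in D and then linearised. *)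
  have [S0 [inj0 dS0]] := D_cocomplete {i : 'I_m & 'I_(r i)}
    (fun x => eobj (FF x)).
  have [S [inj dS']] := eqv_lift_dsum dS0.
  have dS := eqv_is_dsum dS'.
  exists S, inj; split=> //; split=> [|Y SY].
    by apply: (compact_dsum dS) => x; exact: F_compact.
  have [pr [prK _ _]] := dsum_proj dS.
  have FY i s n (f : hom (F i s) (eqv_sh A [set: gT]%G n Y)) : f = 0.
    pose x : {i : 'I_m & 'I_(r i)} := existT _ i s.
    have := prK x; rewrite -[f]cmpm1 => <-.
    by rewrite cmpA (SY n (f \oc pr x)) cmp0m.
  have EY i n (f : hom (eobj (calE i)) (tsh D n (eobj Y))) : f = 0.
    apply: (irr_hom_detect (Y := eqv_sh A [set: gT]%G n Y) (cardH i)
      (rho_irr i) (Fv i)) => s f'.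
    exact: FY.
  have [T [injT [dT [_ T_gen]]]] := E_full.
  suff [Yl Yr] : zero_object (eobj Y).
    by split=> X f; apply: und_inj; [apply: Yl | apply: Yr].
  apply: T_gen => n f; apply: (dsum_ext dT) => -[i j]; rewrite cmp0m.
  (* Every member is a translate of the first in its block, and the linearisation identifies Y[n]
     with g_* Y[n]; since g_* is full, [f'] comes from a map covered by [EY]. *)
  have [g <-] := a_trans i ord0 j.
  have [e] := a_E i g ord0; rewrite -calE_res in e.
  have lamY := lam (eqv_sh A [set: gT]%G n Y) (in_setT g).
  apply: (hom_zero_iso (inv_iso e) lamY) => f'.
  have [f0 f0E] := full_of_ff (ga_ff A g) f'.
  by rewrite -f0E (EY i n f0) fmap0.
- move=> E_str [i s] [j t] n n0; apply: F_van => g; apply: transfer.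
  exact: (E_str (existT (fun i => 'I_(l i).+1) i ord0)
    (existT (fun i => 'I_(l i).+1) j _)).
Qed.
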